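(* Let $f:(0,\infty)\to(0,1]$ be a function that decreases to zero and is regularly varying at infinity with index of regular variation $-\gamma$, where $\gamma\in[0,1)$. Let $c^{\rm glob}_t$ be the global clustering coefficient of the random multigraph $G_t(f)$. Then, for every $\delta\in(0,1)$, there exist positive constants $c_1$ and $c_2$ depending on $\delta$ only such that $$ \mathbb{P}\left(c_1t^{-(1-\gamma)(1+\delta)/2}\le c^{\rm glob}_t\le c_2t^{-(1-\gamma)(1-\delta)/2}\right)\ge 1-\frac{1}{\log t}. $$
   Context: Multigraphs may have loops and multiple edges; a loop contributes 2 to the degree of its vertex. For a finite connected multigraph $G$, $\pi_G$ is the probability distribution on its vertices $\pi_G(v)=\deg(v)/\sum_{w\in G}\deg(w)$. Process $G_t(f)$, indexed by discrete time $t$: let $(Z_t)_{t\ge1}$ be independent with $Z_t\sim\mathrm{Ber}(f(t))$. $G_0$ is one vertex with one self-loop. Given $G_t$: if $Z_{t+1}=1$ (vertex-step), add a new vertex and connect it by one edge to a vertex of $G_t$ chosen according to $\pi_{G_t}$; if $Z_{t+1}=0$ (edge-step), add a new edge between two vertices of $G_t$ chosen independently, each according to $\pi_{G_t}$ (possibly creating a loop or a multiple edge). The result is $G_{t+1}$. For a multigraph $G$ let $\widehat G$ be the simple graph obtained by removing loops and reducing multiple edges to single edges; $\Delta(G)$ is the number of triangles of $\widehat G$ and $\Lambda(G)$ the number of cherries (paths of length two) of $\widehat G$. The global clustering coefficient is $c^{\rm glob}_t=3\,\Delta(G_t(f))/\Lambda(G_t(f))$. A function $f:(0,\infty)\to(0,\infty)$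 is regularly varying at infinity with index $\beta\in\mathbb{R}$ if $\lim_{t\to\infty}f(at)/f(t)=a^{\beta}$ for all $a>0$.
   Formalization: The probability bound is stated for all sufficiently large t, with a threshold depending on δ, γ and f; for all t it fails, e.g. if f = 1 on (0,3] then G_3 has no triangle almost surely, so the lower bound has probability 0 < 1 − 1/log 3. *)

(* Defs.v *)
From HB Require Import structures.
From mathcomp Require Import all_boot all_order all_algebra.
From mathcomp Require Import all_classical all_reals all_analysis.

Set Implicit Arguments.
Unset Strict Implicit.
Unset Printing Implicit Defensive.

Import Order.TTheory GRing.Theory Num.Theory.
Import numFieldNormedType.Exports.

Local Open Scope classical_set_scope.
Local Open Scope ring_scope.

(* A finite multigraph on the vertex set {0, ..., n-1}, given by the list of its
   edges, repetitions allowed.  Each edge is stored with an orientation, which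
   no graph parameter below depends on. *)
Definition multigraph : Type := {n : nat & seq ('I_n * 'I_n)}.

Definition vertex (g : multigraph) : finType := 'I_(tag g).

Definition edges (g : multigraph) : seq (vertex g * vertex g) := tagged g.

Definition MultiGraph (n : nat) (s : seq ('I_n * 'I_n)) : multigraph :=
  Tagged (fun n : nat => seq ('I_n * 'I_n)) s.

(* Both ends of every edge are counted, so that a loop contributes 2. *)
Definition deg (g : multigraph) (v : vertex g) : nat :=
  (count (fun e => e.1 == v) (edges g) + count (fun e => e.2 == v) (edges g))%N.

Definition one_loop : multigraph := @MultiGraph 1 [:: (ord0, ord0)].

Definition add_vertex (g : multigraph) (v : vertex g) : multigraph :=
  let w := widen_ord (leqnSn (tag g)) in
  @MultiGraph (tag g).+1 ((ord_max, w v) :: [seq (w e.1, w e.2) | e <- edges g]).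

Definition add_edge (g : multigraph) (u v : vertex g) : multigraph :=
  @MultiGraph (tag g) ((u, v) :: edges g).

(* Adjacency in the simple graph obtained from g by removing loops and merging
   multiple edges. *)
Definition simple_adj (g : multigraph) (u v : vertex g) : bool :=
  (u != v) && (((u, v) \in edges g) || ((v, u) \in edges g)).

Definition triangles (g : multigraph) : nat :=
  #|[set A : {set vertex g} | (#|A| == 3)
      && [forall u in A, forall v in A, (u != v) ==> simple_adj u v]]%SET|.

(* A path of length two is determined by its centre and the unordered pair of
   its end vertices. *)
Definition cherries (g : multigraph) : nat :=
  #|[set p : vertex g * {set vertex g} | (#|p.2| == 2)
      && [forall v in p.2, simple_adj p.1 v]]%SET|.

Section Process.
Context {R : realType}.

(* Equal to 0 for a graph without cherries, since x / 0 = 0. *)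
Definition global_clustering (g : multigraph) : R :=
  3 * (triangles g)%:R / (cherries g)%:R.

Definition degree_distr (g : multigraph) (v : vertex g) : R :=
  (deg v)%:R / \sum_(w : vertex g) (deg w)%:R.

(* Probability that a step from g leads to g': a vertex-step if b is true, an
   edge-step if b is false. *)
Definition step_prob (b : bool) (g g' : multigraph) : R :=
  if b then
    \sum_(v : vertex g) degree_distr v * (g' == add_vertex v)%:R
  else
    \sum_(u : vertex g) \sum_(v : vertex g)
      degree_distr u * degree_distr v * (g' == add_edge u v)%:R.

Section OnProbabilitySpace.
Context {d : measure_display} {T : measurableType d}.

Definition history (Z : nat -> T -> bool) (G : nat -> T -> multigraph)
    (t : nat) (z : nat -> bool) (g : nat -> multigraph) : set T :=
  [set w | (forall s, (s <= t)%N -> G s w = g s) /\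
           (forall s, (0 < s <= t)%N -> Z s w = z s)].

(* G is the process G_t(f) driven by the step types Z t, t >= 1 (Z 0 plays no
   role).  multigraph is countable and carries the discrete sigma-algebra. *)
Record is_graph_process (f : R -> R) (P : probability T R)
    (Z : nat -> T -> bool) (G : nat -> T -> multigraph) : Prop := {
  steps_measurable : forall t, (0 < t)%N -> measurable_fun [set: T] (Z t);
  graphs_measurable : forall t (A : set multigraph), measurable (G t @^-1` A);
  steps_bernoulli : forall t, (0 < t)%N ->
    P [set w | Z t w = true] = (f t%:R)%:E;
  steps_independent : forall (J : seq nat) (z : nat -> bool),
    uniq J -> (forall s, s \in J -> (0 < s)%N) ->
    P [set w | forall s, s \in J -> Z s w = z s] =
    (\prod_(s <- J) P [set w | Z s w = z s])%E;
  initial_graph : forall w, G 0%N w = one_loop;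
  step_fresh : forall t z g (b : bool),
    P (history Z G t z g `&` [set w | Z t.+1 w = b]) =
    (P (history Z G t z g) * P [set w | Z t.+1 w = b])%E;
  (* the conditional law of G (t+1), with the conditioning event's probability
     multiplied out *)
  step_law : forall t z g (b : bool) (g' : multigraph),
    P (history Z G t z g `&` [set w | Z t.+1 w = b]
         `&` [set w | G t.+1 w = g']) =
    (P (history Z G t z g `&` [set w | Z t.+1 w = b])
       * (step_prob b (g t) g')%:E)%E
}.

End OnProbabilitySpace.

(* Only the values of f on ]0, +oo[ matter. *)
Definition regularly_varying (f : R -> R) (beta : R) : Prop :=
  (forall x, 0 < x -> 0 < f x) /\
  (forall a, 0 < a -> f (a * t) / f t @[t --> +oo] --> a `^ beta).

Definition decreases_to_zero (f : R -> R) : Prop :=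
  (forall x y, 0 < x -> x <= y -> f y <= f x) /\ f t @[t --> +oo] --> 0.

End Process.

(* Main.v *)
(* Put a = 1 - gamma.  The graph at time t is the state of a finite Markov chain, so
   every probability is a finite iterated average and supermartingale estimates can be
   read off one step at a time.  Write u for the number of edges and d_i for degrees.
   Each error probability is O(t^-eps), which beats 1 / log t.
   - Few simple edges: sum_i d_i^a and the sum over ordered pairs of
     (1 if adjacent, C (d_i d_j / u)^a otherwise) grow like t^(a + eps), since a pair
     with d_i d_j >= u pays in advance for becoming adjacent.  Hence there are at most
     t^(a + eps) vertices and simple edges.
   - A hub: E (d_i^(-1/2)) decreases like t^(-1/2), so vertex 0 has degree t^(1 - eps),
     and a proportion t^(-eps) of the roughly t^a vertices born after time t / 2 attach
     to it.  This gives about t^(2 a) cherries.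
   - A near-clique: the roughly t^(a / 2) vertices born before time t^(1/2 - eps) mostly
     reach degree t^(1/2 + eps) by time t / 2, after which almost all pairs of them get
     joined.  This gives about t^(3 a / 2) triangles.
   A simple graph with m edges has O(m^(3/2)) triangles, and the number of cherries is
   at most the number of vertices times twice the number of edges. *)

Require Import Defs.
From HB Require Import structures.
From mathcomp Require Import all_boot all_order all_algebra.
From mathcomp Require Import all_classical all_reals all_analysis.
From mathcomp Require Import zify ring lra.
Set Implicit Arguments.
Unset Strict Implicit.
Unset Printing Implicit Defensive.
Import Order.TTheory GRing.Theory Num.Theory.
Import numFieldNormedType.Exports.
Local Open Scope classical_set_scope.
Local Open Scope ring_scope.

(** * Edges and degrees over natural numbers *)

Definition ends (g : multigraph) : seq (nat * nat) :=
  [seq (val e.1, val e.2) | e <- edges g].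

Definition ndeg (g : multigraph) (i : nat) : nat :=
  (count (fun e => e.1 == i) (ends g) + count (fun e => e.2 == i) (ends g))%N.

Definition adj (g : multigraph) (i j : nat) : bool :=
  (i != j) && (((i, j) \in ends g) || ((j, i) \in ends g)).

Lemma ends_add_vertex (g : multigraph) (v : vertex g) :
  ends (add_vertex v) = (tag g, val v) :: ends g.
Proof. by rewrite /ends /= -map_comp. Qed.

Lemma ends_add_edge (g : multigraph) (u v : vertex g) :
  ends (add_edge u v) = (val u, val v) :: ends g.
Proof. by []. Qed.

Lemma ndeg_val (g : multigraph) (v : vertex g) : deg v = ndeg g (val v).
Proof. by rewrite /deg /ndeg /ends !count_map. Qed.

Lemma ndeg_add_vertex (g : multigraph) (v : vertex g) i :
  ndeg (add_vertex v) i = (ndeg g i + (i == val v) + (i == tag g))%N.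
Proof.
rewrite /ndeg ends_add_vertex /= (eq_sym i) (eq_sym i); lia.
Qed.

Lemma ndeg_add_edge (g : multigraph) (u v : vertex g) i :
  ndeg (add_edge u v) i = (ndeg g i + (i == val u) + (i == val v))%N.
Proof.
rewrite /ndeg ends_add_edge /= (eq_sym i) (eq_sym i); lia.
Qed.

Lemma adj_val (g : multigraph) (u v : vertex g) :
  simple_adj u v = adj g (val u) (val v).
Proof.
have inj : injective (fun e : vertex g * vertex g => (val e.1, val e.2)).
  by move=> [a b] [c e] [/val_inj -> /val_inj ->].
by rewrite /simple_adj /adj /ends -(mem_map inj) -(mem_map inj _ (v, u)).
Qed.

Lemma adjC (g : multigraph) i j : adj g i j = adj g j i.
Proof. by rewrite /adj eq_sym orbC. Qed.

Lemma adj_add_vertex (g : multigraph) (v : vertex g) i j :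
  adj (add_vertex v) i j = (i != j) &&
    (adj g i j || ((i, j) == (tag g, val v)) || ((j, i) == (tag g, val v))).
Proof.
rewrite /adj ends_add_vertex !inE; case: (i != j) => //=.
by do 4 case: (_ \in _) || case: (_ == _).
Qed.

Lemma adj_add_edge (g : multigraph) (u v : vertex g) i j :
  adj (add_edge u v) i j = (i != j) &&
    (adj g i j || ((i, j) == (val u, val v)) || ((j, i) == (val u, val v))).
Proof.
rewrite /adj ends_add_edge !inE; case: (i != j) => //=.
by do 4 case: (_ \in _) || case: (_ == _).
Qed.

Lemma ends_lt (g : multigraph) e : e \in ends g ->
  (e.1 < tag g)%N && (e.2 < tag g)%N.
Proof. by case/mapP => -[a b] _ -> /=; rewrite !ltn_ord. Qed.

Lemma ndeg_ge_tag (g : multigraph) i : (tag g <= i)%N -> ndeg g i = 0%N.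
Proof.
move=> hi; apply/eqP; rewrite /ndeg addn_eq0 !eqn0Ngt -!has_count.
by apply/andP; split; apply/hasPn => e /ends_lt /andP[h1 h2]; apply/eqP => h;
  move: h1 h2; rewrite h; lia.
Qed.

Lemma sum_deg (g : multigraph) : (\sum_(w : vertex g) deg w = 2 * size (edges g))%N.
Proof.
have H (F : vertex g * vertex g -> vertex g) :
    (\sum_(w : vertex g) count (fun e => F e == w) (edges g) = size (edges g))%N.
  elim: (edges g) => [|e s IH] /=; first by rewrite big1.
  rewrite big_split /= IH (bigD1 (F e)) //= eqxx big1 ?addn0 //.
  by move=> w; rewrite eq_sym => /negbTE ->.
by rewrite /deg big_split /= !H mul2n addnn.
Qed.

Record valid (s : nat) (g : multigraph) : Prop := Valid {
  valid_size : size (edges g) = s.+1;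
  valid_deg : forall i, (i < tag g)%N -> (0 < ndeg g i)%N }.

Lemma valid_tag_gt0 s (g : multigraph) : valid s g -> (0 < tag g)%N.
Proof.
move=> vg; case: (posnP (tag g)) => // e; move: (valid_size vg).
case: (edges g) => [//|[i j] l] _; have := ltn_ord i.
by rewrite [X in (_ < X)%N]e.
Qed.

(** * The chain of graphs as an expectation operator *)

Section Mean.
Context {R : realType}.
Implicit Types (phi psi : multigraph -> R) (p : nat -> R).

Definition vstep phi (g : multigraph) : R :=
  \sum_(v : vertex g) degree_distr v * phi (add_vertex v).

Definition estep phi (g : multigraph) : R :=
  \sum_(u : vertex g) \sum_(v : vertex g)
    degree_distr u * degree_distr v * phi (add_edge u v).

Definition step (x : R) phi (g : multigraph) : R :=
  x * vstep phi g + (1 - x) * estep phi g.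

(* The expectation of phi after k steps of the chain from a given graph at time s, when
   the step leading to time s is a vertex-step with probability p s. *)
Fixpoint mean p (k s : nat) phi : multigraph -> R :=
  if k is k'.+1 then step (p s.+1) (mean p k' s.+1 phi) else phi.

Lemma valid0 : valid 0 one_loop.
Proof. by split => // -[|]. Qed.

Definition step_closed (Q : nat -> multigraph -> Prop) : Prop :=
  forall s g, Q s g -> (forall v : vertex g, Q s.+1 (add_vertex v)) /\
     (forall u v : vertex g, Q s.+1 (add_edge u v)).

Lemma valid_closed : step_closed valid.
Proof.
move=> s g [h1 h2]; split => [v|u v]; split.
- by rewrite /= size_map h1.
- move=> i /=; rewrite ltnS leq_eqVlt => /orP[/eqP ->|/h2 h];
    rewrite ndeg_add_vertex ?eqxx; lia.
- by rewrite /= h1.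
- by move=> i /= /h2 h; rewrite ndeg_add_edge; lia.
Qed.

Lemma step_closedI (Q1 Q2 : nat -> multigraph -> Prop) :
  step_closed Q1 -> step_closed Q2 -> step_closed (fun s g => Q1 s g /\ Q2 s g).
Proof.
by move=> h1 h2 s g [/h1[a b] /h2[c d]]; split => *; split.
Qed.

Lemma degree_distr_ge0 (g : multigraph) (v : vertex g) : 0 <= degree_distr v :> R.
Proof. by rewrite /degree_distr divr_ge0 // sumr_ge0. Qed.

Lemma degree_distrE s (g : multigraph) (v : vertex g) : valid s g ->
  degree_distr v = (ndeg g (val v))%:R / (2 * s.+1%:R) :> R.
Proof.
move=> [h _]; rewrite /degree_distr ndeg_val; congr (_ / _).
by rewrite -natr_sum sum_deg h natrM.
Qed.

Lemma sum_degree_distr s (g : multigraph) : valid s g ->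
  \sum_(v : vertex g) degree_distr v = 1 :> R.
Proof.
move=> [h _]; rewrite /degree_distr -mulr_suml divff //.
by rewrite -natr_sum sum_deg h natrM mulf_neq0 // pnatr_eq0.
Qed.

Definition probs p := forall s, 0 <= p s.+1 <= 1.

Lemma vstep_le phi psi g :
  (forall v : vertex g, phi (add_vertex v) <= psi (add_vertex v)) ->
  vstep phi g <= vstep psi g.
Proof.
by move=> h; apply: ler_sum => v _; rewrite ler_wpM2l // degree_distr_ge0.
Qed.

Lemma estep_le phi psi g :
  (forall u v : vertex g, phi (add_edge u v) <= psi (add_edge u v)) ->
  estep phi g <= estep psi g.
Proof.
move=> h; apply: ler_sum => u _; apply: ler_sum => v _.
by rewrite ler_wpM2l // mulr_ge0 // degree_distr_ge0.
Qed.

Lemma step_le x phi psi g : 0 <= x <= 1 ->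
  vstep phi g <= vstep psi g -> estep phi g <= estep psi g ->
  step x phi g <= step x psi g.
Proof.
by case/andP=> h0 h1 hv he; rewrite lerD // ler_wpM2l // subr_ge0.
Qed.

Lemma vstepD phi psi g : vstep (phi \+ psi) g = vstep phi g + vstep psi g.
Proof. by rewrite -big_split; apply: eq_bigr => v _; rewrite mulrDr. Qed.

Lemma estepD phi psi g : estep (phi \+ psi) g = estep phi g + estep psi g.
Proof.
rewrite -big_split; apply: eq_bigr => u _; rewrite -big_split.
by apply: eq_bigr => v _; rewrite mulrDr.
Qed.

Lemma vstepZ c phi g : vstep (fun g => c * phi g) g = c * vstep phi g.
Proof. by rewrite mulr_sumr; apply: eq_bigr => v _; rewrite mulrCA. Qed.

Lemma estepZ c phi g : estep (fun g => c * phi g) g = c * estep phi g.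
Proof.
rewrite mulr_sumr; apply: eq_bigr => u _; rewrite mulr_sumr.
by apply: eq_bigr => v _; rewrite mulrCA.
Qed.

Lemma stepD x phi psi g : step x (phi \+ psi) g = step x phi g + step x psi g.
Proof. by rewrite /step vstepD estepD; ring. Qed.

Lemma stepZ x c phi g : step x (fun g => c * phi g) g = c * step x phi g.
Proof. by rewrite /step vstepZ estepZ; ring. Qed.

Lemma step_cst (x c : R) s g : valid s g -> step x (fun=> c) g = c.
Proof.
move=> vg; rewrite /step /vstep /estep -mulr_suml (sum_degree_distr vg).
under eq_bigr => u _ do rewrite -mulr_suml -mulr_sumr (sum_degree_distr vg) mulr1.
by rewrite -mulr_suml (sum_degree_distr vg); ring.
Qed.

Lemma meanD p k s phi psi : mean p k s (phi \+ psi) = mean p k s phi \+ mean p k s psi.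
Proof.
elim: k s => [//|k IH] s /=; rewrite IH; apply/funext => g; exact: stepD.
Qed.

Lemma meanZ p k s c phi g : mean p k s (fun g => c * phi g) g = c * mean p k s phi g.
Proof.
elim: k s g => [//|k IH] s g /=; rewrite -stepZ.
by congr (step _ _ _); apply/funext => g'; exact: IH.
Qed.

Lemma mean_cat p k l s phi : mean p (k + l) s phi = mean p k s (mean p l (s + k) phi).
Proof.
elim: k s => [|k IH] s; first by rewrite add0n addn0.
by rewrite addSn /= IH addSnnS.
Qed.

Lemma mean_le p k s phi psi (Q : nat -> multigraph -> Prop) g :
  probs p -> step_closed Q ->
  (forall g', Q (s + k)%N g' -> phi g' <= psi g') -> Q s g ->
  mean p k s phi g <= mean p k s psi g.
Proof.
move=> hp hQ; elim: k s g => [|k IH] s g; first by rewrite addn0 => h /h.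
rewrite -addSnnS => h /hQ[hv he] /=.
apply: step_le (hp s) _ _; first by apply: vstep_le => v; exact: IH.
by apply: estep_le => u v; exact: IH.
Qed.

Lemma mean_cst p k s (c : R) g : valid s g -> mean p k s (fun=> c) g = c.
Proof.
move=> vg; elim: k s g vg => [//|k IH] s g vg /=.
rewrite -[RHS](step_cst (p s.+1) c vg); have [hv he] := valid_closed vg.
rewrite /step /vstep /estep; congr (_ * _ + _ * _).
  by apply: eq_bigr => v _; rewrite IH.
by apply: eq_bigr => u _; apply: eq_bigr => v _; rewrite IH.
Qed.

Lemma mean_contract p k s (h : multigraph -> R) (c : nat -> R) (Q : nat -> multigraph -> Prop) g :
  probs p -> step_closed Q -> (forall u, (s <= u < s + k)%N -> 0 <= c u) ->
  (forall u g', (s <= u < s + k)%N -> Q u g' -> step (p u.+1) h g' <= c u * h g') ->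
  Q s g -> mean p k s h g <= (\prod_(s <= u < s + k) c u) * h g.
Proof.
move=> hp hQ; elim: k s g => [|k IH] s g hc hs Qg.
  by rewrite addn0 big_geq //= mul1r.
have lt_s : (s < s + k.+1)%N by rewrite addnS ltnS leq_addr.
rewrite big_ltn // -addSnnS /=.
have [hv he] := hQ _ _ Qg.
have IH' g' : Q s.+1 g' ->
    mean p k s.+1 h g' <= (\prod_(s.+1 <= u < s.+1 + k) c u) * h g'.
  by apply: IH => [u hu|u g'' hu]; [apply: hc|apply: hs]; lia.
apply: (@le_trans _ _
  (step (p s.+1) (fun g' => (\prod_(s.+1 <= u < s.+1 + k) c u) * h g') g)).
  apply: step_le (hp s) _ _; first by apply: vstep_le => v; exact: IH'.
  by apply: estep_le => u v; exact: IH'.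
rewrite stepZ -mulrA mulrCA ler_wpM2l ?hs //; last by lia.
by rewrite big_seq_cond prodr_ge0 // => u; rewrite mem_index_iota andbT => hu; apply: hc; lia.
Qed.

Lemma mean_recr p k s phi : mean p k.+1 s phi = mean p k s (step (p (s + k).+1) phi).
Proof. by rewrite -addn1 mean_cat. Qed.

Definition chance p k s (A : multigraph -> bool) : multigraph -> R :=
  mean p k s (fun g => (A g)%:R).

Implicit Types A B : multigraph -> bool.

Lemma chance_le p k s A B (Q : nat -> multigraph -> Prop) g :
  probs p -> step_closed Q -> (forall g', Q (s + k)%N g' -> A g' -> B g') -> Q s g ->
  chance p k s A g <= chance p k s B g.
Proof.
move=> hp hQ h; apply: (mean_le hp hQ) => g' /h.
by case: (A g') => [->//|_]; case: (B g').
Qed.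

Lemma chanceU p k s A B g : probs p -> valid s g ->
  chance p k s (fun g => A g || B g) g <= chance p k s A g + chance p k s B g.
Proof.
move=> hp vg.
have -> : chance p k s A g + chance p k s B g =
  mean p k s ((fun g => (A g)%:R) \+ (fun g => (B g)%:R)) g by rewrite meanD.
apply: (mean_le hp valid_closed) vg => g' _ /=.
by case: (A g'); case: (B g') => /=; rewrite ?lerDl ?addr0 ?add0r.
Qed.

Lemma chance_compl p k s A g : valid s g ->
  chance p k s A g = 1 - chance p k s (fun g => ~~ A g) g.
Proof.
move=> vg; have <- : chance p k s A g + chance p k s (fun g => ~~ A g) g = 1; last by rewrite addrK.
have <- : mean p k s ((fun g => (A g)%:R) \+ (fun g => (~~ A g)%:R)) g =
  chance p k s A g + chance p k s (fun g => ~~ A g) g by rewrite meanD.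
rewrite -[RHS](mean_cst p k 1 vg); congr (mean _ _ _ _ _); apply/funext => g' /=.
by case: (A g'); rewrite ?addr0 ?add0r.
Qed.

Lemma chance_markov p k s A (phi : multigraph -> R) x (Q : nat -> multigraph -> Prop) g :
  probs p -> step_closed Q -> 0 < x ->
  (forall g', Q (s + k)%N g' -> 0 <= phi g') ->
  (forall g', Q (s + k)%N g' -> A g' -> x <= phi g') -> Q s g ->
  chance p k s A g <= mean p k s phi g / x.
Proof.
move=> hp hQ x0 h0 h Qg; rewrite mulrC -meanZ; apply: (mean_le hp hQ) Qg => g' Qg'.
case: (boolP (A g')) => [/(h _ Qg') hx|_]; last by rewrite mulr_ge0 ?h0 ?invr_ge0 // ltW.
by rewrite ler_pdivlMl // mulr1.
Qed.

Lemma chance_le1 p k s A g : probs p -> valid s g -> chance p k s A g <= 1.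
Proof.
move=> hp vg; rewrite -[leRHS](mean_cst p k 1 vg).
by apply: (mean_le hp valid_closed) vg => g' _; case: (A g').
Qed.

Lemma chance_cat_in (Q : nat -> multigraph -> Prop) p k l s A B r g :
  probs p -> step_closed Q -> valid s g -> Q s g -> 0 <= r ->
  (forall g', valid (s + k) g' -> Q (s + k)%N g' -> ~~ B g' ->
     chance p l (s + k) A g' <= r) ->
  chance p (k + l) s A g <= chance p k s B g + r.
Proof.
move=> hp Qc vg Qg r0 h; rewrite {1}/chance mean_cat.
rewrite -[X in _ + X](mean_cst p k r vg).
have -> : chance p k s B g + mean p k s (fun=> r) g =
  mean p k s ((fun g => (B g)%:R) \+ (fun=> r)) g by rewrite meanD.
apply: (mean_le hp (step_closedI valid_closed Qc)) (conj vg Qg) => g' [vg' Qg'] /=.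
case: (boolP (B g')) => [_|hB]; last by rewrite add0r h.
by rewrite (le_trans (chance_le1 _ _ hp vg')) // lerDl.
Qed.

Lemma chance_cat p k l s A B r g : probs p -> valid s g -> 0 <= r ->
  (forall g', valid (s + k) g' -> ~~ B g' -> chance p l (s + k) A g' <= r) ->
  chance p (k + l) s A g <= chance p k s B g + r.
Proof.
move=> hp vg r0 h; apply: (@chance_cat_in (fun _ _ => True)) => // g' vg' _; exact: h.
Qed.

Lemma chance_sub p k s (A B : multigraph -> bool) (g : multigraph) :
  probs p -> valid s g -> (forall g, A g -> B g) -> chance p k s A g <= chance p k s B g.
Proof. by move=> hp vg h; apply: (chance_le hp valid_closed) vg => g' _; exact: h. Qed.

Lemma chance_cat_uniform p k l s (A : multigraph -> bool) r (g : multigraph) :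
  probs p -> valid s g -> 0 <= r ->
  (forall g', valid (s + k)%N g' -> chance p l (s + k) A g' <= r) ->
  chance p (k + l) s A g <= r.
Proof.
move=> hp vg r0 h.
have := @chance_cat p k l s A (fun=> false) r g hp vg r0 (fun g' vg' _ => h g' vg').
by rewrite [chance _ k _ _ _](mean_cst p k 0 vg) add0r.
Qed.

End Mean.

(** * From the process to the chain *)

Lemma sum_preim_le d (T : measurableType d) (R : realType) (P : probability T R)
  (I : choiceType) (F : T -> I) (L : seq I) (B : set T) :
  (forall i, measurable [set w | F w = i]) -> measurable B -> uniq L ->
  (\sum_(i <- L) P (B `&` [set w | F w = i]) <= P B)%E.
Proof.
move=> mF; elim: L B => [|a L IH] B mB /=; first by rewrite big_nil measure_ge0.
case/andP=> aL uL; rewrite big_cons (measureDI P mB (mF a)) addeC.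
apply: leeD => //; apply: le_trans (IH (B `\` [set w | F w = a]) _ uL).
  rewrite big_seq [leRHS]big_seq; apply: lee_sum => i iL.
  apply: le_measure; rewrite ?inE; [exact: measurableI|by apply: measurableI => //; exact: measurableD|].
  move=> w [Bw Fw]; split => //; split=> //= Fa; move: aL; rewrite -Fa Fw iL //.
exact: measurableD.
Qed.

Local Notation on_nat f := (fun s : nat => f s%:R).

Section FromProcess.
Context {R : realType} (f : R -> R) (d : measure_display) (T : measurableType d).
Context (P : probability T R) (Z : nat -> T -> bool) (G : nat -> T -> multigraph).
Hypothesis HP : is_graph_process f P Z G.

Lemma measurable_graph t (g : multigraph) : measurable [set w | G t w = g].
Proof. exact: (graphs_measurable HP t [set g]). Qed.

Lemma measurable_type t (b : bool) : (0 < t)%N -> measurable [set w | Z t w = b].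
Proof.
move=> t0; have := steps_measurable HP t0.
by move=> /(_ measurableT [set b] I); rewrite setTI.
Qed.

Lemma history_rec t z g (b : bool) g' :
  history Z G t z g `&` [set w | Z t.+1 w = b] `&` [set w | G t.+1 w = g'] =
  history Z G t.+1 (fun s => if s == t.+1 then b else z s)
    (fun s => if s == t.+1 then g' else g s).
Proof.
apply/seteqP; split => w /=.
  case=> -[[hG hZ] hb] hg; split => s.
    by rewrite leq_eqVlt ltnS; case: eqP => [-> //|_ /= /hG].
  by case: eqP => [-> //|/eqP ne /andP[h1 h2]]; apply: hZ; lia.
case=> hG hZ; split; [split; [split => s hs|]|].
- by have := hG s; rewrite ltn_eqF ?ltnS // => ->//; apply: leqW.
- case/andP: hs => s0 hs; have := hZ s; rewrite s0 ltn_eqF ?ltnS // => -> //.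
  exact: leqW.
- by have := hZ t.+1; rewrite eqxx ltnS leqnn => ->.
- by have := hG t.+1; rewrite eqxx leqnn => ->.
Qed.

Lemma measurable_history t z g : measurable (history Z G t z g).
Proof.
elim: t z g => [|t IH] z g.
  suff -> : history Z G 0 z g = [set w | G 0%N w = g 0%N] by exact: measurable_graph.
  apply/seteqP; split => w /=; first by case=> + _; apply.
  by move=> h; split => s; [rewrite leqn0 => /eqP ->|case: s].
have -> : history Z G t.+1 z g = history Z G t z g `&` [set w | Z t.+1 w = z t.+1]
    `&` [set w | G t.+1 w = g t.+1].
  rewrite history_rec; congr (history _ _ _ _ _); apply/funext => s;
  by case: eqP => [->|].
apply: measurableI; last exact: measurable_graph.
by apply: measurableI => //; exact: measurable_type.
Qed.

Definition successors (g : multigraph) : seq multigraph := undup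
  ([seq add_vertex v | v <- enum (vertex g)] ++
   [seq add_edge e.1 e.2 | e <- enum {: vertex g * vertex g}]).

Lemma sum_successors g (h : multigraph -> R) g' : g' \in successors g ->
  \sum_(g1 <- successors g) (g1 == g')%:R * h g1 = h g'.
Proof.
move=> hg; rewrite (bigD1_seq g') ?undup_uniq //= eqxx mul1r big1 ?addr0 // => g1.
by move=> /negbTE ->; rewrite mul0r.
Qed.

Lemma sum_step_prob (b : bool) g (h : multigraph -> R) :
  \sum_(g' <- successors g) step_prob b g g' * h g' =
  if b then vstep h g else estep h g.
Proof.
case: b => /=.
  under eq_bigr => g' _ do rewrite mulr_suml.
  rewrite exchange_big; apply: eq_bigr => v _ /=.
  under eq_bigr => g' _ do rewrite -mulrA.
  rewrite -mulr_sumr sum_successors // mem_undup mem_cat map_f ?mem_enum //.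
under eq_bigr => g' _ do rewrite mulr_suml.
rewrite exchange_big; apply: eq_bigr => u _ /=.
under eq_bigr => g' _ do rewrite mulr_suml.
rewrite exchange_big; apply: eq_bigr => v _ /=.
under eq_bigr => g' _ do rewrite -mulrA.
rewrite -mulr_sumr sum_successors // mem_undup mem_cat.
by apply/orP; right; apply/mapP; exists (u, v); rewrite ?mem_enum.
Qed.

Lemma steps_false t : (0 < t)%N -> P [set w | Z t w = false] = (1 - f t%:R)%:E.
Proof.
move=> t0; have -> : [set w | Z t w = false] = ~` [set w | Z t w = true].
  by apply/seteqP; split => w /=; case: (Z t w).
rewrite probability_setC ?steps_bernoulli //; last exact: measurable_type.
by rewrite (steps_bernoulli HP).
Qed.

Lemma mean_history k t z g (A : multigraph -> bool) : (forall s : nat, 0 <= on_nat f s.+1 <= 1) ->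
  (P (history Z G t z g) * (mean (on_nat f) k t (fun g => (A g)%:R) (g t))%:E <=
   P (history Z G t z g `&` [set w | A (G (t + k)%N w)]))%E.
Proof.
move=> hp; elim: k t z g => [|k IH] t z g.
  rewrite addn0 /=; case: (boolP (A (g t))) => hA; last by rewrite mule0 measure_ge0.
  rewrite mule1 (_ : _ `&` _ = history Z G t z g) //.
  by apply/setIidPl => w [/(_ t (leqnn t)) /= -> _].
set B := _ `&` _; have mB : measurable B.
  apply: measurableI; first exact: measurable_history.
  exact: (graphs_measurable HP _ A).
have step_b (b : bool) :
    (P (history Z G t z g) * P [set w | Z t.+1 w = b] *
     (if b then vstep (mean (on_nat f) k t.+1 (fun g => (A g)%:R)) (g t)
      else estep (mean (on_nat f) k t.+1 (fun g => (A g)%:R)) (g t))%:E <=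
    P (B `&` [set w | Z t.+1 w = b]))%E.
  have mBb : measurable (B `&` [set w | Z t.+1 w = b]).
    by apply: measurableI => //; exact: measurable_type.
  apply: le_trans (sum_preim_le P (measurable_graph t.+1) mBb
    (undup_uniq _ : uniq (successors (g t)))).
  rewrite -(step_fresh HP) -sum_step_prob.
  have [a aE] : exists a : R, P (history Z G t z g `&` [set w | Z t.+1 w = b]) = a%:E.
    exists (fine (P (history Z G t z g `&` [set w | Z t.+1 w = b]))).
    rewrite fineK // fin_num_measure //.
    by apply: measurableI; [exact: measurable_history|exact: measurable_type].
  rewrite aE -EFinM mulr_sumr -sumEFin; apply: lee_sum => g' _.
  rewrite mulrA EFinM [X in (X * _)%E]EFinM -aE -(step_law HP) history_rec.
  set z' := fun s => if _ then b else _; set g1 := fun s => if _ then g' else _.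
  have -> : mean (on_nat f) k t.+1 (fun g => (A g)%:R) g' =
    mean (on_nat f) k t.+1 (fun g => (A g)%:R) (g1 t.+1) by rewrite /g1 eqxx.
  apply: le_trans (IH _ _ _) _; rewrite addSnnS.
  apply: le_measure; rewrite ?inE.
  - apply: measurableI; first exact: measurable_history.
    exact: (graphs_measurable HP _ A).
  - by apply: measurableI => //; exact: measurable_graph.
  - rewrite /z' /g1 -history_rec => w /= [[[h1 h2] h3] h4].
    by split => //; split => //; split.
apply: (@le_trans _ _ (\sum_(b <- [:: true; false]) P (B `&` [set w | Z t.+1 w = b]))%E); last first.
  by apply: sum_preim_le => // b; exact: measurable_type.
rewrite !big_cons big_nil adde0; apply: le_trans (leeD (step_b true) (step_b false)).
rewrite (steps_bernoulli HP) // steps_false // /= /step.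
have [a [a0 ->]] : exists a : R, 0 <= a /\ P (history Z G t z g) = a%:E.
  exists (fine (P (history Z G t z g))); split; first by rewrite fine_ge0.
  by rewrite fineK // fin_num_measure //; exact: measurable_history.
by rewrite -!EFinM -EFinD lee_fin; set x := vstep _ _; set y := estep _ _; lra.
Qed.

Lemma chance_le_process (A : multigraph -> bool) t :
  (forall s : nat, 0 <= on_nat f s.+1 <= 1) ->
  ((chance (on_nat f) t 0 A one_loop)%:E <= P [set w | A (G t w)])%E.
Proof.
move=> hp; have := @mean_history t 0 xpredT (fun=> one_loop) A hp.
have -> : history Z G 0 xpredT (fun=> one_loop) = setT.
  apply/seteqP; split => // w _; split => s; last by case: s.
  by rewrite leqn0 => /eqP ->; exact: (initial_graph HP).
by rewrite setTI probability_setT mul1e add0n.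
Qed.

End FromProcess.

(** * Real inequalities *)

Section Analysis.
Context {R : realType}.
Implicit Types (a b x y : R).

(* Combine the tangent inequalities for expR at p * ln (1 + y), at 0 and at ln (1 + y). *)
Lemma powR1D_le (p y : R) : 0 <= p <= 1 -> -1 < y -> (1 + y) `^ p <= 1 + p * y.
Proof.
case/andP=> p0 p1 y1; have w0 : 0 < 1 + y by lra.
rewrite /powR gt_eqF //; set z := ln (1 + y).
have ez : expR z = 1 + y by rewrite lnK.
set E := expR (p * z); have E0 : 0 < E := expR_gt0 _.
have h1 : E * (1 + (1 - p) * z) <= 1 + y.
  have -> : 1 + y = E * expR ((1 - p) * z) by rewrite -expRD -ez; congr expR; ring.
  by rewrite ler_pM2l ?expR_ge1Dx.
have h2 : E * (1 - p * z) <= 1.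
  have {2}-> : 1 = E * expR (- (p * z)) by rewrite -expRD subrr expR0.
  by rewrite ler_pM2l ?expR_ge1Dx.
have h3 := ler_wpM2l p0 h1.
have h4 : (1 - p) * (E * (1 - p * z)) <= (1 - p) * 1 by rewrite ler_wpM2l ?subr_ge0.
nra.
Qed.

Lemma ln_leB1 x : 0 < x -> ln x <= x - 1.
Proof.
move=> x0; rewrite -{1}[x](subrK 1) addrC; apply: le_ln1Dx; lra.
Qed.

Lemma powR_succ_ge b (u : R) : 0 < u -> 0 <= b ->
  u `^ b * (1 + b / (u + 1)) <= (u + 1) `^ b.
Proof.
move=> u0 b0; have u1 : 0 < u + 1 by lra.
have -> : (u + 1) `^ b = u `^ b * ((u + 1) / u) `^ b.
  rewrite -powRM ?divr_ge0 ?ltW //; congr (_ `^ _); field; lra.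
rewrite ler_pM2l ?powR_gt0 //.
rewrite [leRHS]/powR gt_eqF ?divr_gt0 //; apply: le_trans (expR_ge1Dx _).
rewrite lerD2l ler_wpM2l //.
have -> : (u + 1)^-1 = - (u / (u + 1) - 1) by field; lra.
rewrite lerNl -lnV ?posrE ?divr_gt0 // invf_div.
by apply: ln_leB1; rewrite divr_gt0.
Qed.

Lemma expRN_le_inv x : 0 < x -> expR (- x) <= x^-1.
Proof.
move=> x0; rewrite expRN lef_pV2 ?posrE ?expR_gt0 //.
by apply: le_trans (expR_ge1Dx x); lra.
Qed.

Lemma exp1B_le (q : R) (k : nat) : 0 <= q <= 1 -> (1 - q) ^+ k <= expR (- (q * k%:R)).
Proof.
case/andP=> q0 q1; rewrite -mulNr expRM_natr lerXn2r ?nnegrE ?expR_ge0 //.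
- by rewrite subr_ge0.
- exact: expR_ge1Dx.
Qed.

Lemma prod_1B_le (a : R) s k : 0 <= a <= 1 ->
  \prod_(s <= u < s + k) (1 - a / u.+1%:R) <= (s.+1%:R / (s + k).+1%:R) `^ a.
Proof.
case/andP=> a0 a1; elim: k => [|k IH].
  by rewrite addn0 big_geq // divff ?pnatr_eq0 // powR1.
rewrite addnS big_nat_recr ?leq_addr //=.
have n0 n : 0 < n.+1%:R :> R by rewrite ltr0Sn.
have f0 u : 0 <= 1 - a / u.+1%:R.
  by rewrite subr_ge0 ler_pdivrMr // mul1r (le_trans a1) // ler1n.
apply: le_trans (ler_wpM2r (f0 _) IH) _.
have -> : s.+1%:R / (s + k).+2%:R = (s.+1%:R / (s + k).+1%:R) * ((s + k).+1%:R / (s + k).+2%:R) :> R.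
  by rewrite mulrA divfK ?pnatr_eq0.
rewrite [leRHS]powRM ?divr_ge0 ?ler0n // ler_wpM2l ?powR_ge0 //.
apply: le_trans (expR_ge1Dx _) _.
rewrite /powR gt_eqF ?divr_gt0 // ler_expR.
rewrite -mulrN ler_wpM2l // lerNl -lnV ?posrE ?divr_gt0 // invf_div.
apply: le_trans (ln_leB1 _) _; first by rewrite divr_gt0.
by rewrite -(natr1 (s + k).+1) mulrDl divff ?pnatr_eq0 // addrC addKr mul1r.
Qed.

Lemma power_growth (x : nat -> R) (a b B : R) (u0 : nat) :
  0 <= a -> a < b -> 0 <= B -> (0 < u0)%N -> a + b <= (b - a) * u0%:R ->
  (forall u, (u0 <= u)%N -> x u.+1 <= (1 + a / u%:R) * x u + B * u%:R `^ (b - 1)) ->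
  forall u, (u0 <= u)%N -> x u <= (`|x u0| + 2 * B / (b - a)) * u%:R `^ b.
Proof.
move=> a0 ab B0 u00 hu0 hx; set K := _ + _.
have ba : 0 < b - a by rewrite subr_gt0.
have K0 : 0 <= K by rewrite addr_ge0 // divr_ge0 // ?mulr_ge0 // ltW.
elim => [|u IH]; first by rewrite leqn0 -(negbK (u0 == _)) -lt0n u00.
rewrite leq_eqVlt => /orP[/eqP <-|].
  apply: le_trans (ler_norm _) _; apply: (@le_trans _ _ K).
    by rewrite lerDl divr_ge0 ?mulr_ge0 // ltW.
  have h : u0%:R `^ 0 <= u0%:R `^ b :> R by rewrite ler_powR ?ler1n //; lra.
  by rewrite ler_peMr //; rewrite powRr0 in h.
rewrite ltnS => hu; apply: le_trans (hx _ hu) _.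
have u0R : 0 < u%:R :> R by rewrite ltr0n (leq_trans u00).
have c0 : 0 <= 1 + a / u%:R by rewrite addr_ge0 // divr_ge0 // ltW.
apply: le_trans (lerD (ler_wpM2l c0 (IH hu)) (lexx _)) _.
have b0 : 0 <= b by lra.
rewrite -natr1; apply: le_trans (ler_wpM2l K0 (powR_succ_ge u0R b0)).
have -> : u%:R `^ (b - 1) = u%:R `^ b / u%:R.
  rewrite powRB; first by rewrite powRr1 // ltW.
  by rewrite (gt_eqF u0R) implybT.
set W := u%:R `^ b; have W0 : 0 <= W by apply: powR_ge0.
have -> : (1 + a / u%:R) * (K * W) + B * (W / u%:R) =
  W * (K * (1 + a / u%:R) + B / u%:R) by ring.
rewrite mulrCA ler_wpM2l //.
have hB : B <= K * ((b - a) / 2).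
  rewrite mulrDl; have -> : 2 * B / (b - a) * ((b - a) / 2) = B by field; lra.
  by rewrite lerDr mulr_ge0 // divr_ge0 // ltW.
have hb : (a + b) / 2 / u%:R <= b / (u%:R + 1).
  have huR : u0%:R <= u%:R :> R by rewrite ler_nat.
  rewrite -mulrA -invfM ler_pdivrMr ?mulr_gt0 // -mulrAC ler_pdivlMr; last by lra.
  nra.
have : B / u%:R <= K * ((b - a) / 2) / u%:R by rewrite ler_wpM2r // invr_ge0 ltW.
have := ler_wpM2l K0 hb.
set iu := u%:R^-1; lra.
Qed.

(* Chosen so that invsqrt d - invsqrt d.+1 = invsqrt d / (2 d) exactly: the power
   d `^ (-1/2) itself decreases too slowly from d = 1. *)
Definition invsqrt (d : nat) : R := \prod_(1 <= k < d) (1 - (2 * k%:R)^-1).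

Lemma invsqrtS d : (0 < d)%N -> invsqrt d.+1 = invsqrt d * (1 - (2 * d%:R)^-1).
Proof. by move=> d0; rewrite /invsqrt big_nat_recr. Qed.

Lemma invsqrt1 : invsqrt 1 = 1.
Proof. by rewrite /invsqrt big_geq. Qed.

Lemma invsqrt_gt0 d : 0 < invsqrt d.
Proof.
case: d => [|d]; first by rewrite /invsqrt big_geq.
elim: d => [|d IH]; first by rewrite invsqrt1.
rewrite invsqrtS // mulr_gt0 // subr_gt0 invf_lt1 ?mulr_gt0 //.
have : 1 <= d.+1%:R :> R by rewrite ler1n.
lra.
Qed.

Lemma invsqrt_le1 d : invsqrt d <= 1.
Proof.
case: d => [|d]; first by rewrite /invsqrt big_geq.
elim: d => [|d IH]; first by rewrite invsqrt1.
rewrite invsqrtS // mulr_ile1 ?(ltW (invsqrt_gt0 _)) // ?gerBl ?subr_ge0 ?invr_ge0 //.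
rewrite invf_le1 //; have : 1 <= d.+1%:R :> R by rewrite ler1n.
lra.
Qed.

Lemma invsqrt_ge d : (0 < d)%N -> 1 <= 2 * Num.sqrt d%:R * invsqrt d.
Proof.
move=> d0; suff h : 1 <= (2 * Num.sqrt d%:R * invsqrt d) ^+ 2.
  have y0 : 0 <= 2 * Num.sqrt d%:R * invsqrt d.
    by rewrite !mulr_ge0 ?sqrtr_ge0 // ltW // invsqrt_gt0.
  by rewrite leNgt; apply/negP => y1; nra.
rewrite !exprMn sqr_sqrtr ?ler0n //.
case: d d0 => [//|[|d] _]; first by rewrite invsqrt1; lra.
apply: (@le_trans _ _ (2 ^+ 2 * d.+1%:R * invsqrt d.+2 ^+ 2)); last first.
  by rewrite ler_wpM2r ?sqr_ge0 // ler_wpM2l ?ler_nat.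
elim: d => [|d IH]; first by rewrite invsqrtS // invsqrt1; lra.
apply: le_trans IH _; rewrite [invsqrt d.+3]invsqrtS //.
have D0 : 0 < d.+2%:R :> R by rewrite ltr0n.
have -> : d.+1%:R = d.+2%:R - 1 :> R by rewrite -(natr1 d.+1) addrK.
set D := d.+2%:R in D0 *; set i := invsqrt _.
have -> : 2 ^+ 2 * D * (i * (1 - (2 * D)^-1)) ^+ 2 =
  2 ^+ 2 * i ^+ 2 * (D - 1 + (4 * D)^-1) by field; rewrite gt_eqF.
have h : 0 <= 2 ^+ 2 * i ^+ 2 * (4 * D)^-1.
  have D4 : 0 <= (4 * D)^-1 by rewrite invr_ge0 mulr_ge0 // ltW.
  by rewrite mulr_ge0 // mulr_ge0 // sqr_ge0.
by rewrite [leRHS]mulrDr mulrAC lerDl.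
Qed.

End Analysis.

(** * One-step drifts *)

Section Drift.
Context {R : realType}.
Implicit Types (phi : multigraph -> R).

Lemma sum_degree_distr_eq s (g : multigraph) i : valid s g ->
  \sum_(v : vertex g) degree_distr v * (i == val v)%:R =
  (ndeg g i)%:R / (2 * s.+1%:R) :> R.
Proof.
move=> vg; case: (ltnP i (tag g)) => hi; last first.
  rewrite ndeg_ge_tag // mul0r big1 // => v _.
  by rewrite gtn_eqF ?mulr0 // (leq_trans (ltn_ord v)).
rewrite (bigD1 (Ordinal hi : vertex g)) //= eqxx mulr1 big1 ?addr0 ?(degree_distrE _ vg) //.
by move=> v ne; rewrite eq_sym (_ : (val v == i) = false) ?mulr0 //; apply/negbTE.
Qed.

Lemma vstep_affine s (g : multigraph) phi i j (a b c : R) : valid s g ->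
  (forall v : vertex g, phi (add_vertex v) <= a + b * (i == val v)%:R + c * (j == val v)%:R) ->
  vstep phi g <= a + b * ((ndeg g i)%:R / (2 * s.+1%:R))
                   + c * ((ndeg g j)%:R / (2 * s.+1%:R)).
Proof.
move=> vg h; rewrite -!(sum_degree_distr_eq _ vg).
apply: (@le_trans _ _ (\sum_(v : vertex g) degree_distr v *
   (a + b * (i == val v)%:R + c * (j == val v)%:R))).
  by apply: ler_sum => v _; rewrite ler_wpM2l ?degree_distr_ge0.
rewrite !mulr_sumr -{2}[a]mul1r -(sum_degree_distr vg) mulr_suml -!big_split /=.
by apply: ler_sum => v _; rewrite le_eqVlt; apply/orP; left; apply/eqP; ring.
Qed.

Lemma estep_affine s (g : multigraph) phi i j (a b c e : R) : valid s g ->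
  (forall u v : vertex g, phi (add_edge u v) <=
     a + b * ((i == val u)%:R + (i == val v)%:R) + c * ((j == val u)%:R + (j == val v)%:R)
       + e * ((i == val u)%:R * (j == val v)%:R + (j == val u)%:R * (i == val v)%:R)) ->
  estep phi g <= a + 2 * b * ((ndeg g i)%:R / (2 * s.+1%:R))
    + 2 * c * ((ndeg g j)%:R / (2 * s.+1%:R))
    + 2 * e * ((ndeg g i)%:R / (2 * s.+1%:R) * ((ndeg g j)%:R / (2 * s.+1%:R))).
Proof.
move=> vg h; set wi := (ndeg g i)%:R / _; set wj := (ndeg g j)%:R / _.
pose I (u : vertex g) : R := (i == val u)%:R; pose J (u : vertex g) : R := (j == val u)%:R.
have eI : \sum_(v : vertex g) degree_distr v * I v = wi by exact: sum_degree_distr_eq.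
have eJ : \sum_(v : vertex g) degree_distr v * J v = wj by exact: sum_degree_distr_eq.
have e1 : \sum_(v : vertex g) degree_distr v = 1 :> R by exact: sum_degree_distr vg.
apply: (@le_trans _ _ (\sum_(u : vertex g) degree_distr u *
   (a + b * (I u + wi) + c * (J u + wj) + e * (I u * wj + J u * wi)))).
  apply: ler_sum => u _.
  have -> : a + b * (I u + wi) + c * (J u + wj) + e * (I u * wj + J u * wi) =
      \sum_(v : vertex g) degree_distr v * (a + b * (I u + I v) + c * (J u + J v)
       + e * (I u * J v + J u * I v)).
    transitivity (\sum_(v : vertex g) ((a + b * I u + c * J u) * degree_distr v +
      (b + e * J u) * (degree_distr v * I v) + (c + e * I u) * (degree_distr v * J v))).
      by rewrite !big_split -!mulr_sumr eI eJ e1 /=; ring.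
    by apply: eq_bigr => v _; ring.
  rewrite mulr_sumr; apply: ler_sum => v _.
  by rewrite -mulrA ler_wpM2l ?degree_distr_ge0 // ler_wpM2l ?degree_distr_ge0.
rewrite le_eqVlt; apply/orP; left; apply/eqP.
transitivity (\sum_(v : vertex g) ((a + b * wi + c * wj) * degree_distr v +
      (b + e * wj) * (degree_distr v * I v) + (c + e * wi) * (degree_distr v * J v))).
  by apply: eq_bigr => v _; ring.
by rewrite !big_split -!mulr_sumr eI eJ e1 /=; ring.
Qed.

Lemma ndeg_add_vertex_old (g : multigraph) (v : vertex g) i : (i < tag g)%N ->
  ndeg (add_vertex v) i = (ndeg g i + (i == val v))%N.
Proof. by move=> hi; rewrite ndeg_add_vertex (ltn_eqF hi) addn0. Qed.

Lemma step_invsqrt s (g : multigraph) i (x eta : R) : valid s g -> (i < tag g)%N ->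
  0 <= x <= eta -> eta <= 1 -> 1 <= eta * s.+1%:R ->
  step x (fun g => invsqrt (ndeg g i)) g <=
    (1 - (1 - eta) / 2 / s.+1%:R) * invsqrt (ndeg g i).
Proof.
move=> vg hi /andP[x0 xeta] eta1 hs.
have d0 : (0 < ndeg g i)%N := valid_deg vg hi.
set d := ndeg g i in d0 *; set h := invsqrt d.
have h0 : 0 < h := invsqrt_gt0 d.
have dR : 0 < d%:R :> R by rewrite ltr0n.
have u0 : 0 < s.+1%:R :> R by rewrite ltr0n.
have D1 : invsqrt d.+1 = h * (1 - (2 * d%:R)^-1) by rewrite invsqrtS.
have D2 : invsqrt d.+2 = h * (1 - (2 * d%:R)^-1) * (1 - (2 * (d%:R + 1))^-1).
  by rewrite invsqrtS // D1 natr1.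
have hv : vstep (fun g => invsqrt (ndeg g i)) g <= h * (1 - (4 * s.+1%:R)^-1).
  have := @vstep_affine s g (fun g => invsqrt (ndeg g i)) i i h (- (h / (2 * d%:R))) 0 vg.
  rewrite mul0r addr0 => H; apply: le_trans (H _) _ => [v|].
    rewrite ndeg_add_vertex_old // -/d; case: (i == _); rewrite /= ?addn0 ?addn1 ?D1 ?mulr0 ?mulr1 ?mul0r ?addr0.
      by rewrite le_eqVlt; apply/orP; left; apply/eqP; field; rewrite gt_eqF.
    by [].
  by rewrite le_eqVlt; apply/orP; left; apply/eqP; field; rewrite !gt_eqF.
have he : estep (fun g => invsqrt (ndeg g i)) g <=
    h * (1 - (2 * s.+1%:R)^-1 + 3 / (16 * s.+1%:R ^+ 2)).
  have := @estep_affine s g (fun g => invsqrt (ndeg g i)) i i h (- (h / (2 * d%:R))) 0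
    (h * 3 / (8 * d%:R * (d%:R + 1))) vg.
  move=> H; apply: le_trans (H _) _ => [u v|].
    have D20 (k r : R) : 0 < r -> k * (1 - (2 * r)^-1) * (1 - (2 * (r + 1))^-1) =
        k - k / (2 * r) * 2 + 2 * (k * 3 / (8 * r * (r + 1))).
      by move=> r0; field; rewrite ?gt_eqF //; lra.
    have D10 (k r : R) : 0 < r -> k * (1 - (2 * r)^-1) = k - k / (2 * r).
      by move=> r0; field; rewrite ?gt_eqF.
    rewrite ndeg_add_edge -/d; case: (i == _); case: (i == _);
      rewrite /= ?addn0 ?addn1 ?D1 ?D2 ?D20 // ?D10 // -/h le_eqVlt;
      apply/orP; left; apply/eqP; ring.
  rewrite -/d.
  have -> : 2 * (h * 3 / (8 * d%:R * (d%:R + 1))) *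
      (d%:R / (2 * s.+1%:R) * (d%:R / (2 * s.+1%:R))) =
     h * (3 / (16 * s.+1%:R ^+ 2)) * (d%:R / (d%:R + 1)).
    by field; rewrite !gt_eqF //; lra.
  have le1 : h * (3 / (16 * s.+1%:R ^+ 2)) * (d%:R / (d%:R + 1)) <= h * (3 / (16 * s.+1%:R ^+ 2)).
    rewrite ler_piMr //; last by rewrite ler_pdivrMr; lra.
    by rewrite mulr_ge0 ?divr_ge0 ?mulr_ge0 ?sqr_ge0 // ltW.
  apply: le_trans (lerD (lexx _) le1) _.
  by rewrite le_eqVlt; apply/orP; left; apply/eqP; field; rewrite !gt_eqF.
have x1 : 0 <= 1 - x by lra.
apply: le_trans (lerD (ler_wpM2l x0 hv) (ler_wpM2l x1 he)) _.
rewrite [leRHS]mulrC.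
rewrite (mulrCA x) (mulrCA (1 - x)) -mulrDr ler_pM2l //.
set u := s.+1%:R in u0 hs *.
have u1 : 1 <= u by rewrite ler1n.
have -> : (4 * u)^-1 = u^-1 / 4 by field; rewrite gt_eqF.
have -> : (2 * u)^-1 = u^-1 / 2 by field; rewrite gt_eqF.
have -> : 3 / (16 * u ^+ 2) = u^-1 * (u^-1 * 3 / 16) by field; rewrite gt_eqF.
have iu : 0 < u^-1 by rewrite invr_gt0.
have hu : u^-1 <= eta by rewrite -[u^-1]mul1r ler_pdivrMr.
set y := u^-1 in iu hu *.
have h1 : x * y <= eta * y by rewrite ler_wpM2r // ltW.
have h2 : y * y <= eta * y by rewrite ler_wpM2r // ltW.
have h3 : 0 <= x * (y * y) by rewrite !mulr_ge0 // ltW.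
nra.
Qed.

Lemma step_half_tag s (g : multigraph) (x : R) : valid s g ->
  step x (fun g => 2^-1 ^+ tag g) g = (1 - x / 2) * 2^-1 ^+ tag g.
Proof.
move=> vg; have c1 := step_cst 1 (2^-1 ^+ tag g : R) vg.
have c0 := step_cst 0 (2^-1 ^+ tag g : R) vg.
rewrite /step subrr mul0r addr0 mul1r in c1.
rewrite /step subr0 mul0r add0r mul1r in c0.
rewrite /step (_ : estep _ _ = 2^-1 ^+ tag g) //.
have -> : vstep (fun g => 2^-1 ^+ tag g) g = 2^-1 * 2^-1 ^+ tag g :> R.
  rewrite -[in RHS]c1 -vstepZ; apply: eq_bigr => v _; congr (_ * _).
  by rewrite exprS.
by move: (2^-1 ^+ tag g) => h; field.
Qed.

Lemma adj_add_vertex_ge (g : multigraph) (v : vertex g) i j :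
  adj g i j -> adj (add_vertex v) i j.
Proof. by rewrite adj_add_vertex => h; rewrite h andbT; case/andP: h. Qed.

Lemma adj_add_edge_ge (g : multigraph) (u v : vertex g) i j :
  adj g i j -> adj (add_edge u v) i j.
Proof. by rewrite adj_add_edge => h; rewrite h andbT; case/andP: h. Qed.

Definition nbrs (g : multigraph) (i : nat) : nat := \sum_(j < tag g) adj g i j.

Lemma nbrs_add_vertex (g : multigraph) (v : vertex g) i : (i < tag g)%N ->
  (nbrs g i + (i == val v) <= nbrs (add_vertex v) i)%N.
Proof.
move=> hi; rewrite /nbrs /= big_ord_recr /= leq_add //.
  apply: leq_sum => j _.
  by case: (boolP (adj g i j)) => // /(adj_add_vertex_ge v) ->.
case: (i =P val v) => // ->.
by rewrite adj_add_vertex eqxx orbT (ltn_eqF (ltn_ord v)).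
Qed.

Lemma nbrs_add_edge (g : multigraph) (u v : vertex g) i :
  (nbrs g i <= nbrs (add_edge u v) i)%N.
Proof.
apply: leq_sum => j _.
by case: (boolP (adj g i j)) => // /(adj_add_edge_ge u v) ->.
Qed.

Lemma half_exp_le (m n : nat) : (m <= n)%N -> 2^-1 ^+ n <= 2^-1 ^+ m :> R.
Proof. by move=> mn; rewrite ler_wiXn2l //; lra. Qed.

Lemma vstep_le_cst s (g : multigraph) phi (c : R) : valid s g ->
  (forall v : vertex g, phi (add_vertex v) <= c) -> vstep phi g <= c.
Proof.
move=> vg h; have := @vstep_affine s g phi 0 0 c 0 0 vg.
rewrite !mul0r !addr0; apply => v; by rewrite !mul0r !addr0.
Qed.

Lemma estep_le_cst s (g : multigraph) phi (c : R) : valid s g ->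
  (forall u v : vertex g, phi (add_edge u v) <= c) -> estep phi g <= c.
Proof.
move=> vg h; have := @estep_affine s g phi 0 0 c 0 0 0 vg.
rewrite !mulr0 !mul0r !addr0; apply => u v; by rewrite !mul0r !addr0.
Qed.

Lemma step_half_nbrs s (g : multigraph) i (x q y : R) : valid s g -> (i < tag g)%N ->
  0 <= x <= 1 -> 0 <= q <= x -> 0 <= y -> y <= (ndeg g i)%:R / (2 * s.+1%:R) ->
  step x (fun g => 2^-1 ^+ nbrs g i) g <= (1 - q * y / 2) * 2^-1 ^+ nbrs g i.
Proof.
move=> vg hi /andP[x0 x1] /andP[q0 qx] y0 yw; set h : R := 2^-1 ^+ nbrs g i.
have h0 : 0 < h by rewrite exprn_gt0 //; lra.
have hv : vstep (fun g => 2^-1 ^+ nbrs g i) g <=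
    h - h / 2 * ((ndeg g i)%:R / (2 * s.+1%:R)).
  have := @vstep_affine s g (fun g => 2^-1 ^+ nbrs g i) i i h (- (h / 2)) 0 vg.
  rewrite mul0r addr0 mulNr; apply => v; rewrite mul0r addr0.
  apply: le_trans (half_exp_le (nbrs_add_vertex v hi)) _; rewrite exprD.
  by rewrite -/h; case: (_ == _); rewrite /= ?expr0 ?expr1; lra.
have he : estep (fun g => 2^-1 ^+ nbrs g i) g <= h.
  by apply: estep_le_cst vg _ => u v; apply: half_exp_le; exact: nbrs_add_edge.
have x1' : 0 <= 1 - x by lra.
apply: le_trans (lerD (ler_wpM2l x0 hv) (ler_wpM2l x1' he)) _.
set w := _ / _ in yw *.
have qy : q * y <= x * w by rewrite ler_pM.
have := ler_wpM2l (ltW h0) qy; lra.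
Qed.

Lemma step_nadj s (g : multigraph) i j (x q y : R) : valid s g -> i != j ->
  0 <= x <= 1 -> 0 <= q <= 1 - x -> 0 <= y -> y <= (ndeg g i)%:R / (2 * s.+1%:R) ->
  y <= (ndeg g j)%:R / (2 * s.+1%:R) ->
  step x (fun g => (~~ adj g i j)%:R) g <= (1 - 2 * q * y ^+ 2) * (~~ adj g i j)%:R.
Proof.
move=> vg ij /andP[x0 x1] /andP[q0 qx] y0 yi yj.
set h : R := (~~ adj g i j)%:R; have h0 : 0 <= h by rewrite ler0n.
have hv : vstep (fun g => (~~ adj g i j)%:R) g <= h.
  apply: vstep_le_cst vg _ => v; rewrite ler_nat.
  by case: (boolP (adj g i j)) => [/(adj_add_vertex_ge v) ->|_] //=; case: (adj _ _ _).
set wi := _ / _ in yi; set wj := _ / _ in yj.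
have he : estep (fun g => (~~ adj g i j)%:R) g <= h - 2 * h * (wi * wj).
  have := @estep_affine s g (fun g => (~~ adj g i j)%:R) i j h 0 0 (- h) vg.
  rewrite !mulr0 !mul0r !addr0 mulrN mulNr; apply => u v.
  rewrite !mul0r !addr0 /h.
  case: (boolP (adj g i j)) => [/(adj_add_edge_ge u v) ->|_] /=; first by rewrite oppr0 mul0r addr0.
  rewrite adj_add_edge ij !xpair_eqE /=.
  have : ~~ ((i == val u) && (j == val u)).
    by apply: contra ij => /andP[/eqP -> /eqP ->].
  case: (i == _); case: (j == _); case: (j == _); case: (i == _) => //= _;
    rewrite ?orbT /=; try lra; case: (adj _ _ _) => /=; lra.
have x1' : 0 <= 1 - x by lra.
apply: le_trans (lerD (ler_wpM2l x0 hv) (ler_wpM2l x1' he)) _.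
have yy : y ^+ 2 <= wi * wj by rewrite expr2 ler_pM.
have qy : q * y ^+ 2 <= (1 - x) * (wi * wj) by rewrite ler_pM // sqr_ge0.
have := ler_wpM2l h0 qy; lra.
Qed.

Definition degpow (p : R) (i : nat) (g : multigraph) : R := (ndeg g i)%:R `^ p.

Definition powsum (p : R) (g : multigraph) : R := \sum_(i < tag g) degpow p i g.

Lemma degpow_ge0 p i g : 0 <= degpow p i g.
Proof. exact: powR_ge0. Qed.

Lemma degpowD (p : R) (d k : nat) : 0 <= p <= 1 -> (0 < d)%N ->
  (d + k)%:R `^ p <= d%:R `^ p * (1 + p * (k%:R / d%:R)) :> R.
Proof.
move=> p01 d0; have dR : 0 < d%:R :> R by rewrite ltr0n.
have -> : (d + k)%:R = d%:R * (1 + k%:R / d%:R) :> R.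
  by rewrite natrD mulrDr mulr1 mulrCA divff ?gt_eqF // mulr1.
have k0 : 0 <= k%:R / d%:R :> R by rewrite divr_ge0.
rewrite powRM ?addr_ge0 // ler_wpM2l ?powR_ge0 //.
by apply: powR1D_le => //; lra.
Qed.

Lemma vstep_sum (n : nat) (F : nat -> multigraph -> R) g :
  vstep (fun g' => \sum_(i < n) F i g') g = \sum_(i < n) vstep (F i) g.
Proof.
rewrite /vstep [RHS]exchange_big; apply: eq_bigr => v _ /=.
by rewrite mulr_sumr.
Qed.

Lemma estep_sum (n : nat) (F : nat -> multigraph -> R) g :
  estep (fun g' => \sum_(i < n) F i g') g = \sum_(i < n) estep (F i) g.
Proof.
rewrite /estep [RHS]exchange_big; apply: eq_bigr => u _ /=.
rewrite [RHS]exchange_big; apply: eq_bigr => v _ /=.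
by rewrite mulr_sumr.
Qed.

Lemma ndeg_add_vertex_new (g : multigraph) (v : vertex g) :
  ndeg (add_vertex v) (tag g) = 1%N.
Proof. by rewrite ndeg_add_vertex ndeg_ge_tag // eqxx (gtn_eqF (ltn_ord v)). Qed.

Lemma step_powsum s (g : multigraph) (x p : R) : valid s g -> 0 <= x <= 1 ->
  0 <= p <= 1 -> step x (powsum p) g <= (1 + p / s.+1%:R) * powsum p g + x.
Proof.
move=> vg /andP[x0 x1] p01; have /andP[p0 p1] := p01.
have u0 : 0 < s.+1%:R :> R by rewrite ltr0n.
have term (c : R) i : (i < tag g)%N -> degpow p i g + c * (p * degpow p i g / (ndeg g i)%:R) *
    ((ndeg g i)%:R / (2 * s.+1%:R)) = degpow p i g * (1 + c * p / (2 * s.+1%:R)).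
  move=> hi; have := valid_deg vg hi; rewrite -(ltr0n R) => d0.
  by field; rewrite !gt_eqF.
have hv : vstep (powsum p) g <= (1 + p / (2 * s.+1%:R)) * powsum p g + 1.
  have -> : vstep (powsum p) g =
      vstep ((fun g' => \sum_(i < tag g) degpow p i g') \+ (fun=> 1)) g.
    apply: eq_bigr => v _; congr (_ * _); rewrite /powsum big_ord_recr /=; congr (_ + _).
    by rewrite /degpow ndeg_add_vertex_new powR1.
  rewrite vstepD lerD //; last exact: vstep_le_cst vg _.
  rewrite vstep_sum mulr_sumr; apply: ler_sum => i _.
  rewrite [leRHS]mulrC.
  rewrite -[p / (2 * _)]mul1r mulrA -term // mul1r.
  have := @vstep_affine s g (degpow p i) i i (degpow p i g)
     (p * degpow p i g / (ndeg g i)%:R) 0 vg.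
  rewrite mul0r addr0; apply => v; rewrite mul0r addr0 {1}/degpow ndeg_add_vertex_old //.
  apply: le_trans (degpowD _ p01 (valid_deg vg (ltn_ord i))) _.
  by rewrite /degpow; lra.
have he : estep (powsum p) g <= (1 + p / s.+1%:R) * powsum p g.
  have -> : estep (powsum p) g = estep (fun g' => \sum_(i < tag g) degpow p i g') g by [].
  rewrite estep_sum mulr_sumr; apply: ler_sum => i _.
  rewrite [leRHS]mulrC (_ : p / s.+1%:R = 2 * p / (2 * s.+1%:R)); last by field; rewrite gt_eqF.
  rewrite -term //.
  have := @estep_affine s g (degpow p i) i i (degpow p i g)
     (p * degpow p i g / (ndeg g i)%:R) 0 0 vg.
  rewrite !mulr0 !mul0r !addr0; apply => u v.
  rewrite !mul0r !addr0 {1}/degpow ndeg_add_edge -addnA.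
  apply: le_trans (degpowD _ p01 (valid_deg vg (ltn_ord i))) _.
  by rewrite natrD /degpow; lra.
have x1' : 0 <= 1 - x by lra.
apply: le_trans (lerD (ler_wpM2l x0 hv) (ler_wpM2l x1' he)) _.
have S0 : 0 <= powsum p g by apply: sumr_ge0 => i _; apply: degpow_ge0.
have -> : (2 * s.+1%:R)^-1 = s.+1%:R^-1 / 2 :> R by field; rewrite gt_eqF.
have : 0 <= p / s.+1%:R * powsum p g by rewrite mulr_ge0 // divr_ge0.
set z := p / s.+1%:R * powsum p g => z0.
have := mulr_ge0 x0 z0; rewrite /z.
by move: (s.+1%:R^-1) (powsum p g) => iu S h; nra.
Qed.

Lemma tag_le_powsum s (g : multigraph) (p : R) : valid s g -> 0 <= p ->
  (tag g)%:R <= powsum p g.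
Proof.
move=> vg p0; rewrite -[X in X%:R]card_ord -sumr_const; apply: ler_sum => i _.
have d1 : 1 <= (ndeg g i)%:R :> R by rewrite ler1n (valid_deg vg (ltn_ord i)).
have := ler_powR d1 p0; by rewrite powRr0.
Qed.

Definition pairpot (C p u : R) (i j : nat) (g : multigraph) : R :=
  if adj g i j then 1 else C * ((ndeg g i)%:R * (ndeg g j)%:R / u) `^ p.

Definition pot (C p u : R) (g : multigraph) : R :=
  \sum_(i < tag g) \sum_(j < tag g)
    if val i == val j then 0 else pairpot C p u i j g.

Lemma pairpot_ge0 C p u i j g : 0 <= C -> 0 <= pairpot C p u i j g.
Proof. by move=> C0; rewrite /pairpot; case: ifP => // _; rewrite mulr_ge0 ?powR_ge0. Qed.

Lemma powR_prod_le (p u a b A B : R) : 0 <= p <= 1 -> 0 < u -> 0 < a -> 0 < b ->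
  0 <= A -> 0 <= B ->
  ((a + A) * (b + B) / (u + 1)) `^ p <= (a * b / u) `^ p *
    (1 - p / (u + 1) + p * u / (u + 1) * (A / a + B / b + A * B / (a * b))).
Proof.
move=> p01 u0 a0 b0 A0 B0; have u1 : 0 < u + 1 by lra.
pose w := (a + A) * (b + B) / (a * b) * (u / (u + 1)).
have w0 : 0 <= w.
  by rewrite mulr_ge0 // divr_ge0 ?mulr_ge0 ?addr_ge0 // ltW.
have -> : (a + A) * (b + B) / (u + 1) = (a * b / u) * w.
  by rewrite /w; field; rewrite !gt_eqF.
rewrite powRM //; last by rewrite divr_ge0 ?mulr_ge0 // ltW.
rewrite ler_wpM2l ?powR_ge0 //.
have -> : 1 - p / (u + 1) + p * u / (u + 1) * (A / a + B / b + A * B / (a * b)) =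
   1 + p * (w - 1) by rewrite /w; field; rewrite !gt_eqF.
have -> : w `^ p = (1 + (w - 1)) `^ p by congr (_ `^ _); ring.
apply: powR1D_le => //.
suff : 0 < w by lra.
by rewrite mulr_gt0 ?divr_gt0 ?mulr_gt0 ?ltr_wpDr.
Qed.

Lemma vstep_pairpot s (g : multigraph) (C p : R) i j : valid s g -> i != j ->
  (i < tag g)%N -> (j < tag g)%N -> 0 <= p <= 1 -> 0 <= C ->
  vstep (pairpot C p (s.+1%:R + 1) i j) g <= pairpot C p s.+1%:R i j g.
Proof.
move=> vg ij hi hj p01 C0; have u0 : 0 < s.+1%:R :> R by rewrite ltr0n.
rewrite {2}/pairpot; case: (boolP (adj g i j)) => hadj.
  by apply: vstep_le_cst vg _ => v; rewrite /pairpot adj_add_vertex_ge.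
have di : 0 < (ndeg g i)%:R :> R by rewrite ltr0n (valid_deg vg hi).
have dj : 0 < (ndeg g j)%:R :> R by rewrite ltr0n (valid_deg vg hj).
set Y := _ `^ p.
have := @vstep_affine s g (pairpot C p (s.+1%:R + 1) i j) i j
  (C * (Y * (1 - p / (s.+1%:R + 1)))) (C * (Y * (p * s.+1%:R / (s.+1%:R + 1) / (ndeg g i)%:R)))
  (C * (Y * (p * s.+1%:R / (s.+1%:R + 1) / (ndeg g j)%:R))) vg.
move=> H; apply: le_trans (H _) _ => [v|].
  have -> : pairpot C p (s.+1%:R + 1) i j (add_vertex v) =
      C * (((ndeg g i)%:R + (i == val v)%:R) * ((ndeg g j)%:R + (j == val v)%:R) / (s.+1%:R + 1)) `^ p.
    rewrite /pairpot adj_add_vertex (negbTE hadj) ij /= !xpair_eqE (ltn_eqF hi) (ltn_eqF hj) /=.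
    by rewrite !ndeg_add_vertex_old // !natrD.
  apply: le_trans (ler_wpM2l C0 (powR_prod_le p01 u0 di dj _ _)) _; rewrite ?ler0n //.
  have -> : (i == val v)%:R * (j == val v)%:R = 0 :> R.
    case: (i =P val v) => [iv|]; last by rewrite mul0r.
    by case: (j =P val v) => [jv|]; [move: ij; rewrite iv jv eqxx|rewrite mulr0].
  rewrite -/Y mul0r addr0; set X := p * _ / _; set e1 := _ / _ ; set e2 := _ / _.
  by rewrite le_eqVlt; apply/orP; left; apply/eqP; rewrite /e1 /e2; ring.
rewrite le_eqVlt; apply/orP; left; apply/eqP; field.
by rewrite !gt_eqF //; lra.
Qed.

Lemma estep_pairpot s (g : multigraph) (C p : R) i j : valid s g -> i != j ->
  (i < tag g)%N -> (j < tag g)%N -> 0 <= p <= 1 -> 1 <= C ->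
  estep (pairpot C p (s.+1%:R + 1) i j) g <=
    (1 + (p + (2 * C)^-1) / s.+1%:R) * pairpot C p s.+1%:R i j g.
Proof.
move=> vg ij hi hj p01 C1; have u0 : 0 < s.+1%:R :> R by rewrite ltr0n.
have C0 : 0 < C by lra.
have /andP[p0 p1] := p01.
rewrite {2}/pairpot; case: (boolP (adj g i j)) => hadj.
  apply: (@le_trans _ _ 1).
    by apply: estep_le_cst vg _ => u v; rewrite /pairpot adj_add_edge_ge.
  by rewrite mulr1 lerDl divr_ge0 ?addr_ge0 ?invr_ge0 ?mulr_ge0 // ltW.
have di : 0 < (ndeg g i)%:R :> R by rewrite ltr0n (valid_deg vg hi).
have dj : 0 < (ndeg g j)%:R :> R by rewrite ltr0n (valid_deg vg hj).
set Y := _ `^ p; have Y0 : 0 <= Y by apply: powR_ge0.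
set x := (ndeg g i)%:R * (ndeg g j)%:R : R in Y Y0 *.
have x0 : 0 < x by rewrite mulr_gt0.
pose k : R := if x <= s.+1%:R then 1 else 0.
have := @estep_affine s g (pairpot C p (s.+1%:R + 1) i j) i j
  (C * (Y * (1 - p / (s.+1%:R + 1)))) (C * (Y * (p * s.+1%:R / (s.+1%:R + 1) / (ndeg g i)%:R)))
  (C * (Y * (p * s.+1%:R / (s.+1%:R + 1) / (ndeg g j)%:R)))
  (C * (Y * (p * s.+1%:R / (s.+1%:R + 1) / x)) + k) vg.
move=> H; apply: le_trans (H _) _ => {H} [u v|].
  set I1 : R := (i == val u)%:R; set I2 : R := (i == val v)%:R.
  set J1 : R := (j == val u)%:R; set J2 : R := (j == val v)%:R.
  have disj (w : vertex g) : (i == val w)%:R * (j == val w)%:R = 0 :> R.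
    case: (i =P val w) => [iv|]; last by rewrite mul0r.
    by case: (j =P val w) => [jv|]; [move: ij; rewrite iv jv eqxx|rewrite mulr0].
  have IJ : (I1 + I2) * (J1 + J2) = I1 * J2 + J1 * I2.
    by rewrite mulrDl !mulrDr !disj add0r addr0 (mulrC I2).
  have I0 : 0 <= I1 + I2 by rewrite addr_ge0 // ler0n.
  have J0 : 0 <= J1 + J2 by rewrite addr_ge0 // ler0n.
  pose W := C * (((ndeg g i)%:R + (I1 + I2)) * ((ndeg g j)%:R + (J1 + J2)) / (s.+1%:R + 1)) `^ p.
  have W0 : 0 <= W by rewrite mulr_ge0 ?powR_ge0 // ltW.
  have E0 : 0 <= I1 * J2 + J1 * I2 by rewrite -IJ mulr_ge0.
  have k0 : 0 <= k by rewrite /k; case: ifP.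
  apply: (@le_trans _ _ (W + k * (I1 * J2 + J1 * I2))); last first.
    have hW := ler_wpM2l (ltW C0) (powR_prod_le p01 u0 di dj I0 J0).
    apply: le_trans (lerD hW (lexx _)) _; rewrite IJ -/x -/Y.
    set X := p * _ / _; set e1 := (I1 + I2) / _; set e2 := (J1 + J2) / _.
    by rewrite le_eqVlt; apply/orP; left; apply/eqP; rewrite /e1 /e2; ring.
  rewrite {1}/pairpot; case: (boolP (adj (add_edge u v) i j)) => hadj'; last first.
    have nE (d a b : nat) : (d + a + b)%:R = d%:R + (a%:R + b%:R) :> R.
      by rewrite !natrD addrA.
    rewrite !ndeg_add_edge !nE -/I1 -/I2 -/J1 -/J2 -/W.
    by rewrite lerDl mulr_ge0.
  have E1 : 1 <= I1 * J2 + J1 * I2.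
    move: hadj'; rewrite adj_add_edge (negbTE hadj) ij /= !xpair_eqE.
    have n1 : 0 <= J1 * I2 by rewrite mulr_ge0 // ler0n.
    have n2 : 0 <= I1 * J2 by rewrite mulr_ge0 // ler0n.
    case/orP => /andP[h1 h2].
      have -> : I1 * J2 = 1 by rewrite /I1 /J2 h1 h2 mulr1.
      by rewrite lerDl.
    have -> : J1 * I2 = 1 by rewrite /J1 /I2 h1 h2 mulr1.
    by rewrite lerDr.
  rewrite /k; case: (leP x s.+1%:R) => hx; first by rewrite mul1r; lra.
  rewrite mul0r addr0 /W; apply: mulr_ege1 => //.
  set X := _ / (s.+1%:R + 1); suff X1 : 1 <= X by have := ler_powR X1 p0; rewrite powRr0.
  rewrite ler_pdivlMr ?mul1r; last by lra.
  have hx' : s.+1%:R + 1 <= x.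
    by move: hx; rewrite /x -natrM ltr_nat natr1 ler_nat.
  rewrite mulrDl !mulrDr -/x; have : 0 <= (ndeg g i)%:R * (J1 + J2) by rewrite mulr_ge0 // ltW.
  have : 0 <= (I1 + I2) * (ndeg g j)%:R by rewrite mulr_ge0 // ltW.
  have : 0 <= (I1 + I2) * (J1 + J2) by rewrite mulr_ge0.
  by rewrite !mulrDr !mulrDl; lra.
have kY : k * (x / s.+1%:R) <= Y.
  rewrite /k; case: (leP x s.+1%:R) => hx; last by rewrite mul0r.
  rewrite mul1r; apply: ger1_powR => //; rewrite divr_gt0 //=.
  by rewrite ler_pdivrMr // mul1r.
have hp : p / (s.+1%:R + 1) * (1 + (2 * s.+1%:R)^-1) <= p / s.+1%:R.
  rewrite -!mulrA ler_wpM2l // mulrC ler_pdivrMr; last by lra.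
  have -> : s.+1%:R^-1 * (s.+1%:R + 1) = 1 + s.+1%:R^-1 :> R by field; rewrite gt_eqF.
  rewrite lerD2l lef_pV2 ?posrE ?mulr_gt0 //; lra.
apply: (@le_trans _ _ (C * Y * (1 + p / (s.+1%:R + 1) * (1 + (2 * s.+1%:R)^-1))
   + k * (x / s.+1%:R) / (2 * s.+1%:R))).
  rewrite le_eqVlt; apply/orP; left; apply/eqP; rewrite /x; field.
  by rewrite !gt_eqF //; lra.
have -> : (1 + (p + (2 * C)^-1) / s.+1%:R) * (C * Y) =
   C * Y * (1 + p / s.+1%:R) + Y / (2 * s.+1%:R) by field; rewrite !gt_eqF.
rewrite lerD // ?ler_wpM2r ?invr_ge0 ?mulr_ge0 ?(ltW u0) // ler_wpM2l ?lerD2l //.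
by rewrite mulr_ge0 // ltW.
Qed.

Lemma pairpotC C p u i j g : pairpot C p u i j g = pairpot C p u j i g.
Proof. by rewrite /pairpot adjC (mulrC (ndeg g i)%:R). Qed.

Lemma pairpot_new s (g : multigraph) (C p : R) i (v : vertex g) : valid s g ->
  (i < tag g)%N -> 0 <= p -> 0 <= C ->
  pairpot C p (s.+1%:R + 1) i (tag g) (add_vertex v) <=
    (i == val v)%:R + C * s.+1%:R `^ (- p) * degpow p i g.
Proof.
move=> vg hi p0 C0; have u0 : 0 < s.+1%:R :> R by rewrite ltr0n.
have h0 : 0 <= C * s.+1%:R `^ (- p) * degpow p i g.
  by rewrite !mulr_ge0 ?powR_ge0.
case: (i =P val v) => [iv|ne].
  rewrite /pairpot adj_add_vertex iv eqxx orbT (ltn_eqF (ltn_ord v)) /= lerDl.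
  by rewrite -iv.
rewrite add0r /pairpot adj_add_vertex !xpair_eqE (ltn_eqF hi) eqxx /=.
rewrite (negbTE (introN eqP ne)) orbF.
have -> : adj g i (tag g) = false.
  apply/negbTE/negP => /andP[_ /orP[/ends_lt|/ends_lt]] /=; rewrite ltnn ?andbF //.
rewrite ndeg_add_vertex_new mulr1 ndeg_add_vertex_old // (negbTE (introN eqP ne)) addn0.
have -> : s.+1%:R `^ (- p) = s.+1%:R^-1 `^ p :> R.
  by rewrite -powR_inv1 ?(ltW u0) // -powRrM mulN1r.
rewrite -mulrA ler_wpM2l // /degpow -powRM ?invr_ge0 ?ler0n // mulrC.
apply: ge0_ler_powR; rewrite ?nnegrE ?mulr_ge0 ?invr_ge0 ?addr_ge0 ?(ltW u0) //.
by rewrite ler_wpM2r // lef_pV2 ?posrE ?addr_gt0 // lerDl.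
Qed.

Lemma step_pot s (g : multigraph) (C p x : R) : valid s g -> 0 <= p <= 1 -> 1 <= C ->
  0 <= x <= 1 ->
  step x (pot C p (s.+1%:R + 1)) g <=
    (1 + (p + (2 * C)^-1) / s.+1%:R) * pot C p s.+1%:R g +
    x * (2 + 2 * C * s.+1%:R `^ (- p) * powsum p g).
Proof.
move=> vg p01 C1 /andP[x0 x1]; have /andP[p0 p1] := p01.
have C0 : 0 <= C by lra.
have u0 : 0 < s.+1%:R :> R by rewrite ltr0n.
pose F i j (g : multigraph) : R := if i == j then 0 else pairpot C p (s.+1%:R + 1) i j g.
pose S := C * s.+1%:R `^ (- p) * powsum p g.
have sum_new (v : vertex g) :
    \sum_(i < tag g) pairpot C p (s.+1%:R + 1) i (tag g) (add_vertex v) <= 1 + S.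
  apply: (@le_trans _ _ (\sum_(i < tag g) ((val i == val v)%:R +
     C * s.+1%:R `^ (- p) * degpow p i g))).
    by apply: ler_sum => i _; exact: pairpot_new.
  rewrite big_split /= -mulr_sumr lerD2r (bigD1 v) //= eqxx big1 ?addr0 // => i ne.
  by rewrite (_ : (i == v :> nat) = false) //; exact: negbTE.
have hv : vstep (pot C p (s.+1%:R + 1)) g <= pot C p s.+1%:R g + 2 * (1 + S).
  apply: (@le_trans _ _ (vstep ((fun g' => \sum_(i < tag g) \sum_(j < tag g) F i j g') \+
      (fun=> 2 * (1 + S))) g)).
    apply: vstep_le => v /=; rewrite /pot /= big_ord_recr /=.
    have -> : \sum_(j < (tag g).+1) (if tag g == j then 0 else
        pairpot C p (s.+1%:R + 1) (tag g) j (add_vertex v)) =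
        \sum_(i < tag g) pairpot C p (s.+1%:R + 1) i (tag g) (add_vertex v).
      rewrite big_ord_recr /= eqxx addr0; apply: eq_bigr => i _.
      by rewrite gtn_eqF // pairpotC.
    have -> : \sum_(i < tag g) \sum_(j < (tag g).+1) (if (i == j :> nat) then 0 else
          pairpot C p (s.+1%:R + 1) i j (add_vertex v)) =
        \sum_(i < tag g) \sum_(j < tag g) F i j (add_vertex v) +
        \sum_(i < tag g) pairpot C p (s.+1%:R + 1) i (tag g) (add_vertex v).
      rewrite -big_split; apply: eq_bigr => i _; rewrite big_ord_recr /= ltn_eqF //.
    have := sum_new v; set A := \sum_(i < _) \sum_(j < _) _; lra.
  rewrite vstepD lerD //; last exact: vstep_le_cst vg _.
  rewrite (vstep_sum _ (fun i g' => \sum_(j < tag g) F i j g')).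
  apply: ler_sum => i _; rewrite (vstep_sum _ (F i)); apply: ler_sum => j _.
  rewrite /F; case: eqP => [_|/eqP ij]; first exact: vstep_le_cst vg _.
  exact: vstep_pairpot.
have he : estep (pot C p (s.+1%:R + 1)) g <= (1 + (p + (2 * C)^-1) / s.+1%:R) * pot C p s.+1%:R g.
  rewrite -[estep _ g]/(estep (fun g' => \sum_(i < tag g) \sum_(j < tag g) F i j g') g).
  rewrite (estep_sum _ (fun i g' => \sum_(j < tag g) F i j g')) mulr_sumr.
  apply: ler_sum => i _; rewrite (estep_sum _ (F i)) mulr_sumr; apply: ler_sum => j _.
  rewrite /F; case: eqP => [_|/eqP ij]; last exact: estep_pairpot.
  by rewrite mulr0; exact: estep_le_cst vg _.
have pot0 : 0 <= pot C p s.+1%:R g.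
  by apply: sumr_ge0 => i _; apply: sumr_ge0 => j _; case: ifP => // _; exact: pairpot_ge0.
have x1' : 0 <= 1 - x by lra.
apply: le_trans (lerD (ler_wpM2l x0 hv) (ler_wpM2l x1' he)) _.
have r0 : 0 <= (p + (2 * C)^-1) / s.+1%:R.
  by rewrite divr_ge0 ?addr_ge0 ?invr_ge0 ?mulr_ge0.
have -> : 2 * C * s.+1%:R `^ (- p) * powsum p g = 2 * S by rewrite /S; ring.
have := mulr_ge0 x0 (mulr_ge0 r0 pot0).
by move: (_ / _) (pot C p s.+1%:R g) => r Q rQ; nra.
Qed.

Definition adjpairs (g : multigraph) : nat := \sum_(i < tag g) nbrs g i.

Lemma adjpairs_le_pot (C p u : R) g : 0 <= C -> (adjpairs g)%:R <= pot C p u g.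
Proof.
move=> C0; rewrite natr_sum; apply: ler_sum => i _; rewrite natr_sum.
apply: ler_sum => j _; case: eqP => [e|_]; first by rewrite /adj e eqxx.
by rewrite /pairpot; case: (adj _ _ _) => //; rewrite mulr_ge0 ?powR_ge0.
Qed.

End Drift.

(** * Counting triangles and cherries *)

Section Counting.
Local Open Scope nat_scope.

Definition tritriples (g : multigraph) : nat :=
  \sum_(i < tag g) \sum_(j < tag g) \sum_(k < tag g)
    (adj g i j && adj g j k && adj g i k).

Lemma sum_indicator_card (I : finType) (P : pred I) : \sum_(i : I) P i = #|[set i | P i]%SET|.
Proof. by rewrite -sum1dep_card [RHS]big_mkcond; apply: eq_bigr => i _; case: (P i). Qed.

Lemma tritriples_card (g : multigraph) :
  tritriples g = #|[set t : vertex g * vertex g * vertex g |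
    adj g (val t.1.1) (val t.1.2) && adj g (val t.1.2) (val t.2) && adj g (val t.1.1) (val t.2)]%SET|.
Proof.
rewrite -sum_indicator_card /tritriples.
rewrite pair_bigA /= pair_bigA /=; by apply: eq_bigr => -[[i j] k].
Qed.

Lemma cards3P (T : finType) (A : {set T}) :
  reflect (exists x y z, [/\ x != y, y != z, x != z & A = [set x; y; z]%SET]) (#|A| == 3).
Proof.
apply: (iffP idP) => [cA|[x [y [z [xy yz xz ->]]]]]; last first.
  by rewrite finset.setUC cardsU1 cards2 !inE xy negb_or !(eq_sym z) xz yz.
have /card_gt0P[z zA] : 0 < #|A| by rewrite (eqP cA).
move: cA; rewrite (cardsD1 z) zA eqSS => /cards2P[x [y [xy e]]].
have: x \in A :\ z by rewrite e !inE eqxx.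
have: y \in A :\ z by rewrite e !inE eqxx orbT.
rewrite !inE => /andP[yz _] /andP[xz _].
by exists x, y, z; split=> //; rewrite -e finset.setUC finset.setD1K.
Qed.

Lemma triangles_le (g : multigraph) : triangles g <= tritriples g.
Proof.
rewrite tritriples_card.
set Ts := [set t | _]%SET.
apply: leq_trans (leq_imset_card
  (fun t : vertex g * vertex g * vertex g => [set t.1.1; t.1.2; t.2]%SET) Ts).
apply: subset_leq_card; apply/fintype.subsetP => A; rewrite inE => /andP[/cards3P].
case=> [x [y [z [xy yz xz ->]]]] hA.
have hadj u v : u \in [set x; y; z]%SET -> v \in [set x; y; z]%SET -> u != v ->
    adj g (val u) (val v).
  move=> hu hv uv; rewrite -adj_val.
  by move/forallP: hA => /(_ u) /implyP/(_ hu) /forallP/(_ v) /implyP/(_ hv) /implyP/(_ uv).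
apply/imsetP; exists (x, y, z); rewrite // inE /=.
by rewrite !hadj ?inE ?eqxx ?orbT.
Qed.

Lemma tritriples_le (g : multigraph) : tritriples g <= 27 * triangles g.
Proof.
rewrite tritriples_card -sum1_card /triangles.
set Ts := [set t | _]%SET; set Tri := [set A | _]%SET.
rewrite mulnC -[leqRHS]sum_nat_const.
apply: (@leq_trans (\sum_(t : vertex g * vertex g * vertex g) \sum_(A in Tri)
   [&& t.1.1 \in A, t.1.2 \in A & t.2 \in A])).
  rewrite big_mkcond; apply: leq_sum => -[[x y] z] _.
  case: ifP => //; rewrite inE /= => /andP[/andP[xy yz] xz].
  have ne (u v : vertex g) : adj g (val u) (val v) -> u != v by rewrite -val_eqE => /andP[].
  have hA : [set x; y; z]%SET \in Tri.
    rewrite inE; apply/andP; split.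
      by apply/cards3P; exists x, y, z; rewrite !ne.
    apply/forallP => u; apply/implyP; rewrite !inE => hu.
    apply/forallP => v; apply/implyP; rewrite !inE => hv; apply/implyP => uv.
    rewrite adj_val; move: uv.
    case/orP: hu => [/orP[]|] /eqP ->; case/orP: hv => [/orP[]|] /eqP ->;
      rewrite ?eqxx // => _; by rewrite // adjC.
  rewrite (bigD1 _ hA) /= !inE !eqxx ?orbT /=. by [].
rewrite exchange_big; apply: leq_sum => A; rewrite inE => /andP[/eqP cA _].
rewrite sum_indicator_card.
have -> : [set t : vertex g * vertex g * vertex g | [&& t.1.1 \in A, t.1.2 \in A & t.2 \in A]]%SET =
   finset.setX (finset.setX A A) A by apply/setP => -[[x y] z]; rewrite !inE /= andbA.
by rewrite !cardsX cA.
Qed.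

Lemma sqr_sum_le (I : finType) (a : pred I) (x : I -> nat) :
  (\sum_i a i * x i) ^ 2 <= (\sum_i a i) * \sum_i a i * x i ^ 2.
Proof.
rewrite -(leq_pmul2l (_ : 0 < 2)) //.
have -> : 2 * ((\sum_i a i) * \sum_i a i * x i ^ 2) =
   \sum_i \sum_j (a i * a j * (x i ^ 2 + x j ^ 2)).
  rewrite mul2n -addnn {1}mulnC !big_distrlr /= -big_split /=.
  apply: eq_bigr => i _; rewrite -big_split /=; apply: eq_bigr => j _; lia.
rewrite -mulnn big_distrlr /= big_distrr /=; apply: leq_sum => i _.
rewrite big_distrr /=; apply: leq_sum => j _.
have := nat_Cauchy (x i) (x j); case: (a i); case: (a j); rewrite ?mul1n ?mul0n ?muln0 //.
by case.
Qed.

Lemma adjpairsE g : adjpairs g = \sum_(e : vertex g * vertex g) adj g (val e.1) (val e.2).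
Proof. by rewrite /adjpairs pair_bigA. Qed.

(* The discrete Loomis-Whitney inequality, by Cauchy-Schwarz over the edges (i, j). *)
Lemma tritriples_sqr (g : multigraph) : tritriples g ^ 2 <= adjpairs g ^ 3.
Proof.
have -> : tritriples g = \sum_(e : vertex g * vertex g) adj g (val e.1) (val e.2) *
    \sum_(k < tag g) (adj g (val e.2) k && adj g (val e.1) k).
  rewrite /tritriples pair_bigA /=; apply: eq_bigr => e _; rewrite big_distrr /=.
  by apply: eq_bigr => k _; rewrite -andbA mulnb.
apply: leq_trans (sqr_sum_le _ _) _.
rewrite -adjpairsE expnS leq_mul2l; apply/orP; right.
apply: (@leq_trans (\sum_(i < tag g) \sum_(j < tag g) \sum_(k < tag g) \sum_(l < tag g)
   adj g i k * adj g j l)).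
  rewrite [leqRHS]pair_bigA /=; apply: leq_sum => -[i j] _ /=.
  rewrite -mulnn big_distrlr /= big_distrr /=; apply: leq_sum => k _.
  rewrite big_distrr /=; apply: leq_sum => l _.
  by case: (adj g i j); case: (adj g i k); case: (adj g j k); case: (adj g j l);
    case: (adj g i l).
rewrite -mulnn {1}/adjpairs big_distrl /=; apply: leq_sum => i _.
rewrite exchange_big /nbrs big_distrl /=; apply: leq_sum => k _.
rewrite big_distrr /=; apply: leq_sum => j _; rewrite big_distrr /=.
by apply: leq_sum.
Qed.

Lemma nbrs_le_tag g i : nbrs g i <= tag g.
Proof.
rewrite -[leqRHS]card_ord -sum1_card; apply: leq_sum => j _.
by case: (adj _ _ _).
Qed.

Lemma cherries_le (g : multigraph) : cherries g <= tag g * adjpairs g.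
Proof.
apply: (@leq_trans (\sum_(v : vertex g) nbrs g (val v) * nbrs g (val v))); last first.
  rewrite big_distrr /=; apply: leq_sum => v _; rewrite leq_mul2r nbrs_le_tag orbT //.
pose Ts := [set t : vertex g * (vertex g * vertex g) |
  adj g (val t.1) (val t.2.1) && adj g (val t.1) (val t.2.2)]%SET.
have -> : \sum_(v : vertex g) nbrs g (val v) * nbrs g (val v) = #|Ts|.
  rewrite -sum_indicator_card -(pair_bigA _ (fun v p => (adj g (val v) (val p.1)
     && adj g (val v) (val p.2) : nat))) /=.
  apply: eq_bigr => v _; rewrite -(pair_bigA _ (fun x y => (adj g (val v) (val x)
     && adj g (val v) (val y) : nat))) /= /nbrs big_distrlr /=.
  by apply: eq_bigr => x _; apply: eq_bigr => y _; rewrite mulnb.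
apply: leq_trans (leq_imset_card
  (fun t : vertex g * (vertex g * vertex g) => (t.1, [set t.2.1; t.2.2]%SET)) Ts).
apply: subset_leq_card; apply/fintype.subsetP => -[v A]; rewrite inE /= => /andP[/cards2P].
case=> [x [y [xy ->]]] /forallP hA.
apply/imsetP; exists (v, (x, y)); rewrite // inE /=.
by have := hA x; have := hA y; rewrite !inE !eqxx orbT /= -!adj_val => -> ->.
Qed.

Lemma cherries_ge (g : multigraph) (v : vertex g) : 'C(nbrs g (val v), 2) <= cherries g.
Proof.
pose N := [set w : vertex g | adj g (val v) (val w)]%SET.
have -> : nbrs g (val v) = #|N| by rewrite /nbrs -sum_indicator_card.
rewrite -cards_draws -(card_imset _ (_ : injective (fun A : {set vertex g} => (v, A)))); last first.
  by move=> A B [].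
apply: subset_leq_card; apply/fintype.subsetP => p /imsetP[A]; rewrite !inE => /andP[hA cA] ->.
rewrite cA /=; apply/forallP => w; apply/implyP => wA.
by rewrite adj_val; move/fintype.subsetP: hA => /(_ w wA); rewrite inE.
Qed.

Definition nadjpairs (n : nat) (g : multigraph) : nat :=
  \sum_(i < n) \sum_(j < n) ~~ adj g i j.

Lemma tritriples_ge (g : multigraph) n : n <= tag g ->
  n ^ 3 <= tritriples g + 3 * n * nadjpairs n g.
Proof.
move=> hn; pose B := nadjpairs n g.
have e1 : \sum_(i < n) \sum_(j < n) \sum_(k < n) (~~ adj g i j : nat) = n * B.
  rewrite /B /nadjpairs big_distrr /=; apply: eq_bigr => i _; rewrite big_distrr /=.
  by apply: eq_bigr => j _; rewrite sum_nat_const card_ord.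
have e2 : \sum_(i < n) \sum_(j < n) \sum_(k < n) (~~ adj g j k : nat) = n * B.
  by rewrite sum_nat_const card_ord.
have e3 : \sum_(i < n) \sum_(j < n) \sum_(k < n) (~~ adj g i k : nat) = n * B.
  rewrite -e1; apply: eq_bigr => i _; rewrite exchange_big /=.
  by apply: eq_bigr.
have e0 : \sum_(i < n) \sum_(j < n) \sum_(k < n) 1 = n ^ 3.
  by rewrite !(sum_nat_const, card_ord) /= muln1 !expnS expn0 muln1.
have le3 : \sum_(i < n) \sum_(j < n) \sum_(k < n) (adj g i j && adj g j k && adj g i k)
    <= tritriples g.
  have sub (F : nat -> nat) : \sum_(i < n) F i <= \sum_(i < tag g) F i.
    rewrite -!(big_mkord xpredT) (@big_cat_nat _ _ _ n 0 (tag g)) //= leq_addr //.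
  apply: leq_trans (sub (fun i => \sum_(j < n) \sum_(k < n)
     (adj g i j && adj g j k && adj g i k))) _.
  apply: leq_sum => i _.
  apply: leq_trans (sub (fun j => \sum_(k < n) (adj g i j && adj g j k && adj g i k))) _.
  by apply: leq_sum => j _; exact: (sub (fun k => (adj g i j && adj g j k && adj g i k : nat))).
have -> : 3 * n * nadjpairs n g = n * B + n * B + n * B by rewrite /B; lia.
apply: leq_trans (leq_add le3 (leqnn _)).
rewrite -{1}e1 -{1}e2 -e3 -e0 -!big_split /=; apply: leq_sum => i _.
rewrite -!big_split /=; apply: leq_sum => j _; rewrite -!big_split /=; apply: leq_sum => k _.
by case: (adj g i j); case: (adj g j k); case: (adj g i k).
Qed.

End Counting.

(** * Tail bounds from a fixed graph *)

Section ConditionalBounds.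
Context {R : realType} (p : nat -> R).
Hypothesis hp : probs p.

Definition grows (i : nat) (x : R) (s : nat) (g : multigraph) : Prop :=
  (i < tag g)%N /\ x <= (ndeg g i)%:R.

Lemma grows_closed i x : step_closed (grows i x).
Proof.
move=> s g [hi hx]; split => [v|u v]; split => /=.
- exact: leqW.
- by apply: le_trans hx _; rewrite ler_nat ndeg_add_vertex -addnA leq_addr.
- by [].
- by apply: le_trans hx _; rewrite ler_nat ndeg_add_edge -addnA leq_addr.
Qed.

Lemma low_degree s k (g : multigraph) i (x eta : R) : valid s g -> (i < tag g)%N ->
  0 < eta <= 1 -> 1 <= eta * s.+1%:R -> (forall u, (s < u)%N -> p u <= eta) -> 0 < x ->
  chance p k s (fun g => ((ndeg g i)%:R < x)%R) g <=
    2 * Num.sqrt x * (s.+1%:R / (s + k).+1%:R) `^ ((1 - eta) / 2).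
Proof.
move=> vg hi /andP[eta0 eta1] hs hpe x0.
pose Q s g := valid s g /\ grows i 0 s g.
have Qc : step_closed Q by exact: (@step_closedI valid (grows i 0) valid_closed (@grows_closed i 0)).
have Qg : Q s g by split.
pose h (g : multigraph) : R := invsqrt (ndeg g i).
have sx : 0 < Num.sqrt x by rewrite sqrtr_gt0.
apply: le_trans (@chance_markov _ p k s _ h (2 * Num.sqrt x)^-1 Q g hp Qc _ _ _ Qg) _.
- by rewrite invr_gt0 mulr_gt0.
- by move=> g' _; rewrite ltW // invsqrt_gt0.
- move=> g' [vg' [hi' _]] hx; have d0 := valid_deg vg' hi'.
  rewrite -[leLHS]mul1r ler_pdivrMr ?mulr_gt0 // mulrC.
  apply: le_trans (invsqrt_ge d0) _; rewrite ler_wpM2r ?(ltW (invsqrt_gt0 _)) //.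
  by rewrite ler_wpM2l // ler_wsqrtr // ltW.
rewrite invrK mulrC ler_wpM2l ?mulr_ge0 ?sqrtr_ge0 //.
have e01 : 0 <= (1 - eta) / 2 <= 1 by apply/andP; split; lra.
have /andP[e0 e1] := e01.
apply: le_trans (prod_1B_le s k e01).
apply: le_trans (@mean_contract _ p k s h (fun u => 1 - (1 - eta) / 2 / u.+1%:R) Q g hp Qc _ _ Qg) _.
- move=> u _; rewrite subr_ge0 ler_pdivrMr ?ltr0n // mul1r (le_trans e1) // ler1n //.
- move=> u g' hu [vg' [hi' _]]; apply: step_invsqrt => //.
    by case/andP: (hp u) => -> _ /=; apply: hpe; lia.
  by apply: le_trans hs _; rewrite ler_wpM2l ?(ltW eta0) // ler_nat; lia.
rewrite ler_piMr ?invsqrt_le1 //; apply: prodr_ge0 => u _.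
by rewrite subr_ge0 ler_pdivrMr ?ltr0n // mul1r (le_trans e1) // ler1n.
Qed.

Lemma half_pow_ge (n : nat) (m : R) : n%:R < m -> expR (- m) <= 2^-1 ^+ n.
Proof.
move=> nm; have e2 : 2 <= expR 1 :> R by have := @expR_ge1Dx R 1; lra.
apply: (@le_trans _ _ (expR (-1) ^+ n)).
  by rewrite -expRM_natr mulN1r ler_expR lerN2 ltW.
by rewrite lerXn2r ?nnegrE ?expR_ge0 ?invr_ge0 // expRN lef_pV2 ?posrE ?expR_gt0.
Qed.

Lemma few_nbrs s k (g : multigraph) i (x m fl : R) : valid s g -> (i < tag g)%N ->
  0 <= x -> x <= (ndeg g i)%:R -> 0 <= fl ->
  (forall u, (s < u <= s + k)%N -> fl <= p u) -> (0 < k)%N ->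
  chance p k s (fun g => ((nbrs g i)%:R < m)%R) g <=
    expR (m - fl * x * k%:R / (4 * (s + k)%:R)).
Proof.
move=> vg hi x0 hx fl0 hfl k0.
pose Q s g := valid s g /\ grows i x s g.
have Qc : step_closed Q by exact: (@step_closedI valid (grows i x) valid_closed (@grows_closed i x)).
have Qg : Q s g by split.
pose h (g : multigraph) : R := 2^-1 ^+ nbrs g i.
have h0 g' : 0 <= h g' by rewrite exprn_ge0 // invr_ge0.
apply: le_trans (@chance_markov _ p k s _ h (expR (- m)) Q g hp Qc _ _ _ Qg) _.
- exact: expR_gt0.
- by move=> g' _; exact: h0.
- by move=> g' _ /half_pow_ge.
have sk0 : 0 < (s + k)%:R :> R by rewrite ltr0n; lia.
have fl1 : fl <= 1.
  by apply: le_trans (hfl (s + k)%N _) _; [lia|move: (hp (s + k).-1); rewrite prednK; [case/andP|lia]].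
pose y := x / (2 * (s + k)%:R).
have y0 : 0 <= y by rewrite divr_ge0 // mulr_ge0 // ltW.
have y1 : y <= 1.
  rewrite /y ler_pdivrMr ?mulr_gt0 // mul1r; apply: le_trans hx _.
  have -> : 2 * (s + k)%:R = (2 * (s + k))%:R :> R by rewrite natrM.
  rewrite ler_nat; apply: (@leq_trans (2 * s.+1)); last by lia.
  rewrite -(valid_size vg) -sum_deg (bigD1 (Ordinal hi : vertex g)) //= ndeg_val leq_addr //.
rewrite -expRN opprK mulrC addrC expRD mulrC ler_wpM2r ?expR_ge0 //.
have q01 : 0 <= fl * y / 2 <= 1.
  have : fl * y <= 1 by rewrite mulr_ile1.
  by have := mulr_ge0 fl0 y0; lra.
apply: (@le_trans _ _ ((1 - fl * y / 2) ^+ k)); last first.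
  apply: le_trans (exp1B_le k q01) _.
  rewrite ler_expR lerN2 le_eqVlt; apply/orP; left; apply/eqP; rewrite /y.
  by move: (_%:R) (gt_eqF sk0) => w w0; field; rewrite w0.
apply: le_trans (@mean_contract _ p k s h (fun u => 1 - fl * y / 2) Q g hp Qc _ _ Qg) _.
- by move=> u _; case/andP: q01 => *; lra.
- move=> u g' hu [vg' [hi' hx']]; apply: (step_half_nbrs vg' hi' (hp u) _ y0) => //.
    by rewrite fl0 hfl //; lia.
  rewrite /y ler_pM ?invr_ge0 ?mulr_ge0 ?(ltW sk0) // lef_pV2 ?posrE ?mulr_gt0 ?ltr0Sn //.
  by rewrite ler_wpM2l // ler_nat; case/andP: hu.
rewrite /= prodr_const_nat addKn ler_piMr ?exprn_ge0 //; first by case/andP: q01 => *; lra.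
by rewrite exprn_ile1 // ?invr_ge0 // invf_le1 //; lra.
Qed.

Lemma few_vertices s k (g : multigraph) (m fl : R) : valid s g ->
  0 <= fl <= 1 -> (forall u, (s < u <= s + k)%N -> fl <= p u) ->
  chance p k s (fun g => ((tag g)%:R < m)%R) g <= expR (m - fl * k%:R / 2).
Proof.
move=> vg /andP[fl0 fl1] hfl.
pose h (g : multigraph) : R := 2^-1 ^+ tag g.
have h0 g' : 0 <= h g' by rewrite exprn_ge0 // invr_ge0.
apply: le_trans (@chance_markov _ p k s _ h (expR (- m)) valid g hp valid_closed _ _ _ vg) _.
- exact: expR_gt0.
- by move=> g' _; exact: h0.
- by move=> g' _ /half_pow_ge.
rewrite -expRN opprK mulrC expRD ler_wpM2l ?expR_ge0 //.
have q01 : 0 <= fl / 2 <= 1 by apply/andP; split; lra.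
apply: (@le_trans _ _ ((1 - fl / 2) ^+ k)); last first.
  by apply: le_trans (exp1B_le k q01) _; rewrite mulrAC.
apply: le_trans (@mean_contract _ p k s h (fun u => 1 - fl / 2) valid g hp valid_closed _ _ vg) _.
- by move=> u _; case/andP: q01 => *; lra.
- move=> u g' hu vg'; rewrite (step_half_tag _ vg') ler_wpM2r ?h0 //.
  have : fl <= p u.+1 by apply: hfl; lia.
  by lra.
rewrite /= prodr_const_nat addKn ler_piMr ?exprn_ge0 //; first by lra.
by rewrite exprn_ile1 // ?invr_ge0 // invf_le1 //; lra.
Qed.

Lemma few_edges s k (g : multigraph) i j (x : R) : valid s g -> i != j ->
  (i < tag g)%N -> (j < tag g)%N -> 0 <= x -> x <= (ndeg g i)%:R -> x <= (ndeg g j)%:R ->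
  (forall u, (s < u)%N -> p u <= 2^-1) -> (0 < k)%N ->
  chance p k s (fun g => ~~ adj g i j) g <=
    expR (- (x ^+ 2 * k%:R / (4 * (s + k)%:R ^+ 2))).
Proof.
move=> vg ij hi hj x0 hxi hxj hpu k0.
pose Q s g := (valid s g /\ grows i x s g) /\ grows j x s g.
have Qc : step_closed Q.
  apply: (@step_closedI (fun s g => valid s g /\ grows i x s g) (grows j x)); last exact: grows_closed.
  exact: (@step_closedI valid (grows i x) valid_closed (@grows_closed i x)).
have Qg : Q s g by do 2 split.
have sk0 : 0 < (s + k)%:R :> R by rewrite ltr0n; lia.
pose y := x / (2 * (s + k)%:R).
have y0 : 0 <= y by rewrite divr_ge0 // mulr_ge0 // ltW.
have y1 : y <= 1.
  rewrite /y ler_pdivrMr ?mulr_gt0 // mul1r; apply: le_trans hxi _.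
  have -> : 2 * (s + k)%:R = (2 * (s + k))%:R :> R by rewrite natrM.
  rewrite ler_nat; apply: (@leq_trans (2 * s.+1)); last by lia.
  rewrite -(valid_size vg) -sum_deg (bigD1 (Ordinal hi : vertex g)) //= ndeg_val leq_addr //.
have q01 : 0 <= y ^+ 2 <= 1 by rewrite sqr_ge0 exprn_ile1.
apply: (@le_trans _ _ ((1 - y ^+ 2) ^+ k)); last first.
  apply: le_trans (exp1B_le k q01) _.
  rewrite ler_expR lerN2 le_eqVlt; apply/orP; left; apply/eqP; rewrite /y.
  by move: (_%:R) (gt_eqF sk0) => w w0; field; rewrite w0.
apply: le_trans (@mean_contract _ p k s (fun g => (~~ adj g i j)%:R) (fun u => 1 - y ^+ 2) Q g hp Qc _ _ Qg) _.
- by move=> u _; case/andP: q01 => *; lra.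
- move=> u g' hu [[vg' [hi' hxi']] [hj' hxj']].
  have -> : 1 - y ^+ 2 = 1 - 2 * 2^-1 * y ^+ 2 by field.
  have hu' : (0 < u.+1%:R :> R) by rewrite ltr0n.
  have yb (d : R) : x <= d -> y <= d / (2 * u.+1%:R).
    move=> xd; rewrite /y ler_pM ?invr_ge0 ?mulr_ge0 ?(ltW sk0) //.
    rewrite lef_pV2 ?posrE ?mulr_gt0 //.
    by rewrite ler_wpM2l // ler_nat; case/andP: hu.
  apply: (step_nadj vg' ij (hp u) _ y0); [|exact: yb|exact: yb].
  by apply/andP; split; [rewrite invr_ge0|have h : p u.+1 <= 2^-1 by [apply: hpu; case/andP: hu]; clear -h; lra].
rewrite /= prodr_const_nat addKn ler_piMr ?exprn_ge0 //; first by case/andP: q01 => *; lra.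
by case: (adj g i j).
Qed.

Lemma mean_sum (I : Type) (r : seq I) k s (F : I -> multigraph -> R) g :
  mean p k s (fun g => \sum_(i <- r) F i g) g = \sum_(i <- r) mean p k s (F i) g.
Proof.
elim: r => [|i r IH].
  rewrite big_nil (_ : (fun g => \sum_(i <- [::]) F i g) = (fun g => 0 * 0)).
    by rewrite meanZ mul0r.
  by apply/funext => g'; rewrite big_nil mul0r.
rewrite big_cons -IH.
have -> : (fun g => \sum_(j <- i :: r) F j g) = F i \+ (fun g => \sum_(j <- r) F j g).
  by apply/funext => g'; rewrite big_cons.
by rewrite meanD.
Qed.

Lemma few_triples s k (g : multigraph) (r : R) : valid s g -> 0 <= r ->
  (forall i j : nat, (i < tag g)%N -> (j < tag g)%N -> i != j ->
     chance p k s (fun g => ~~ adj g i j) g <= r) ->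
  chance p k s (fun g' => (2 * tritriples g' < tag g ^ 3)%N) g <= 6 * ((tag g)%:R^-1 + r).
Proof.
move=> vg r0 hr; set n := tag g.
have n0 : (0 < n)%N := valid_tag_gt0 vg.
have nR : 0 < n%:R :> R by rewrite ltr0n.
pose Q (s : nat) (g : multigraph) := is_true (n <= tag g)%N.
have Qc : step_closed Q by move=> s' g' h; split => * //=; exact: leqW.
apply: le_trans (@chance_markov _ p k s _ (fun g => (nadjpairs n g)%:R) (n%:R ^+ 2 / 6) Q g hp Qc _ _ _ (leqnn _)) _.
- by rewrite divr_gt0 ?exprn_gt0.
- by move=> *; rewrite ler0n.
- move=> g' Qg' hT; rewrite ler_pdivrMr // -natrX -natrM ler_nat.
  have := tritriples_ge Qg'; move: hT; rewrite -/n => h1 h2.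
  rewrite -(leq_pmul2l n0); move: h1 h2.
  by rewrite !expnS expn0 muln1; move: (n * (n * n))%N => N; nia.
have hB : mean p k s (fun g => (nadjpairs n g)%:R) g <= n%:R + n%:R ^+ 2 * r.
  rewrite (_ : (fun g => (nadjpairs n g)%:R) =
     fun g => \sum_(i < n) \sum_(j < n) (~~ adj g i j)%:R); last first.
    by apply/funext => g'; rewrite natr_sum; apply: eq_bigr => i _; rewrite natr_sum.
  rewrite mean_sum.
  have -> : n%:R + n%:R ^+ 2 * r = \sum_(i < n) (1 + n%:R * r).
    by rewrite sumr_const card_ord -[RHS]mulr_natl mulrDr mulr1 mulrA.
  apply: ler_sum => i _; rewrite mean_sum (bigD1 i) //=; apply: lerD.
    exact: chance_le1.
  have -> : n%:R * r = \sum_(j < n) r by rewrite sumr_const card_ord mulr_natl.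
  rewrite [leRHS](bigD1 i) //= ler_wpDl //; apply: ler_sum => j ji.
  by apply: hr; rewrite ?ltn_ord // eq_sym.
apply: le_trans (ler_wpM2r _ hB) _; first by rewrite invr_ge0 divr_ge0 ?exprn_ge0.
by rewrite le_eqVlt; apply/orP; left; apply/eqP; field; rewrite gt_eqF.
Qed.

End ConditionalBounds.

(** * Asymptotics and regular variation *)

Section Asymptotics.
Context {R : realType}.
Implicit Types (a b K : R).

Lemma near_powR_le a b K : a < b -> \forall t \near \oo, K * t%:R `^ a <= t%:R `^ b.
Proof.
move=> ab; have ba : 0 < b - a by rewrite subr_gt0.
near=> t; have t0 : 0 < t%:R :> R by rewrite ltr0n; near: t; exact: nbhs_infty_gt.
have -> : t%:R `^ b = t%:R `^ (b - a) * t%:R `^ a.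
  by rewrite -powRD ?subrK // (gt_eqF t0) implybT.
rewrite ler_wpM2r ?powR_ge0 //; apply: le_trans (ler_norm K) _.
have -> : `|K| = (`|K| `^ (b - a)^-1) `^ (b - a) by rewrite -powRrM mulVf ?gt_eqF // powRr1.
apply: ge0_ler_powR; rewrite ?nnegrE ?powR_ge0 ?ler0n ?(ltW ba) //.
by near: t; exact: nbhs_infty_ger.
Unshelve. all: by end_near. Qed.

Lemma ln_le_powR a (x : R) : 0 < a -> 0 < x -> ln x <= a^-1 * x `^ a.
Proof.
move=> a0 x0; rewrite -ler_pdivrMl ?invr_gt0 // invrK -ln_powR.
by apply: le_trans (ln_leB1 _) _; rewrite ?powR_gt0 // gerBl.
Qed.

Lemma near_inv_ln a K : 0 < a ->
  \forall t \near \oo, K * t%:R `^ (- a) <= (8 * ln t%:R)^-1.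
Proof.
move=> a0; have a2 : 0 < a / 2 by rewrite divr_gt0.
have h1 := @near_powR_le (- a) (- (a / 2)) (K * (8 * (a / 2)^-1)).
near=> t; have t1 : 1 < t%:R :> R by near: t; exact: nbhs_infty_gtr.
have t0 : 0 < t%:R :> R by lra.
have l0 : 0 < ln t%:R :> R by rewrite ln_gt0.
rewrite -[leRHS]mul1r ler_pdivlMr ?mulr_gt0 //.
apply: le_trans (ler_norm _) _.
rewrite !normrM (ger0_norm (powR_ge0 _ _)) (gtr0_norm l0) normr_nat.
have hln := ln_le_powR a2 t0.
have : `|K| * (8 * (a / 2)^-1) * t%:R `^ (- a) <= t%:R `^ (- (a / 2)).
  by near: t; apply: near_powR_le; lra.
move=> h; have pa := powR_gt0 (a / 2) t0.
have : t%:R `^ (- (a / 2)) * t%:R `^ (a / 2) = 1 :> R.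
  by rewrite -powRD ?addNr ?powRr0 // (gt_eqF t0) implybT.
move=> E; rewrite -[leRHS]E; apply: le_trans (ler_wpM2r (ltW pa) h).
set A := `|K|; set B := t%:R `^ (- a); set P := t%:R `^ (a / 2) in hln *.
have -> : A * B * (8 * ln t%:R) = A * B * 8 * ln t%:R by ring.
have -> : A * (8 * (a / 2)^-1) * B * P = A * B * 8 * ((a / 2)^-1 * P) by ring.
by rewrite ler_wpM2l ?mulr_ge0 ?powR_ge0 ?normr_ge0.
Unshelve. all: by end_near. Qed.

Lemma dyadic_bound (g : R -> R) (x0 K : R) : 0 < x0 ->
  (forall x, x0 <= x -> g (2 * x) <= g x) ->
  (forall x, x0 <= x <= 2 * x0 -> g x <= K) ->
  forall x, x0 <= x -> g x <= K.
Proof.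
move=> x00 g2 gK x hx.
have [k hk] : exists k : nat, x <= 2 ^+ k * (2 * x0).
  exists (Num.bound (x / (2 * x0))); rewrite -ler_pdivrMr ?mulr_gt0 // ltW //.
  exact: upper_nthrootP.
elim: k x hx hk => [|k IH] x hx hk.
  by apply: gK; rewrite hx; move: hk; rewrite expr0 mul1r.
case: (leP x (2 * x0)) => hx2; first by apply: gK; rewrite hx.
have -> : x = 2 * (x / 2) by field.
apply: le_trans (g2 _ _) _; first by rewrite ler_pdivlMr // mulrC ltW.
apply: IH; first by rewrite ler_pdivlMr // mulrC ltW.
by rewrite ler_pdivrMr // mulrAC -exprSr.
Qed.

Lemma regvar_bounds (f : R -> R) (gamma eps : R) : 0 <= gamma -> 0 < eps ->
  (forall x, 0 < x -> 0 < f x <= 1) -> decreases_to_zero f ->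
  regularly_varying f (- gamma) ->
  \forall t \near \oo, t%:R `^ (- gamma - eps) <= f t%:R <= t%:R `^ (- gamma + eps).
Proof.
move=> g0 e0 f01 [fdec _] [_ /(_ 2 ltac:(lra)) frv].
pose e := eps / 2; have e2 : 0 < e by rewrite divr_gt0.
have lt2 a b : a < b -> 2 `^ a < 2 `^ b :> R.
  move=> ab; rewrite /powR gt_eqF // ltr_expR ltr_pM2r // ln_gt0 //; lra.
have [x0 x01 hx0] : exists2 x0 : R, 1 <= x0 & forall x, x0 <= x ->
    2 `^ (- gamma - e) <= f (2 * x) / f x <= 2 `^ (- gamma + e).
  have l1 : 2 `^ (- gamma) < 2 `^ (- gamma + e) by apply: lt2; lra.
  have l2 : 2 `^ (- gamma - e) < 2 `^ (- gamma) by apply: lt2; lra.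
  have h1 : \forall t \near +oo, f (2 * t) / f t < 2 `^ (- gamma + e).
    exact: cvgr_lt frv _ l1.
  have h2 : \forall t \near +oo, 2 `^ (- gamma - e) < f (2 * t) / f t.
    exact: cvgr_gt frv _ l2.
  have [M [_ hM]] := filterI h1 h2.
  exists (Num.max 1 (M + 1)); first by rewrite le_max lexx.
  move=> x; rewrite ge_max => /andP[_ hx]; have := hM x ltac:(lra).
  by move=> [a b]; rewrite !ltW.
have pos x : x0 <= x -> 0 < x by move=> h; lra.
have fpos x : x0 <= x -> 0 < f x by move=> /pos/f01/andP[].
have p2 a x : x0 <= x -> (2 * x) `^ a = 2 `^ a * x `^ a.
  by move=> /pos /ltW h; rewrite powRM.
pose K1 := (2 * x0) `^ gamma; pose K2 := (f (2 * x0))^-1.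
have up x : x0 <= x -> f x * x `^ (gamma - e) <= K1.
  apply: (@dyadic_bound (fun x => f x * x `^ (gamma - e)) x0) => [|{}x hx|{}x hx].
  - lra.
  - rewrite p2 // mulrA ler_wpM2r ?powR_ge0 //.
    have /andP[_] := hx0 _ hx; rewrite ler_pdivrMr ?fpos // => h.
    apply: le_trans (ler_wpM2r (powR_ge0 _ _) h) _.
    rewrite mulrAC -powRD ?implybT //; last by rewrite (_ : (2 == 0 :> R) = false) ?implybT // gt_eqF.
    by rewrite (_ : - gamma + e + (gamma - e) = 0) ?powRr0 ?mul1r //; ring.
  - case/andP: hx => hx hx'; have /andP[_ f1] := f01 x (pos _ hx).
    apply: (@le_trans _ _ (1 * x `^ gamma)).
      by rewrite ler_pM ?powR_ge0 ?(ltW (fpos _ hx)) // ler_powR //; lra.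
    rewrite mul1r; apply: ge0_ler_powR => //; rewrite nnegrE; lra.
have lo x : x0 <= x -> x `^ (- gamma - e) / f x <= K2.
  apply: (@dyadic_bound (fun x => x `^ (- gamma - e) / f x) x0) => [|{}x hx|{}x hx].
  - lra.
  - have hx2 : x0 <= 2 * x by lra.
    rewrite p2 // ler_pdivrMr ?fpos //.
    have -> : x `^ (- gamma - e) / f x * f (2 * x) = f (2 * x) / f x * x `^ (- gamma - e) by ring.
    by rewrite ler_wpM2r ?powR_ge0 //; case/andP: (hx0 _ hx).
  - case/andP: hx => hx hx'.
    apply: (@le_trans _ _ (1 / f x)).
      rewrite ler_wpM2r ?invr_ge0 ?(ltW (fpos _ hx)) //.
      have h : x `^ (- gamma - e) <= x `^ 0 by apply: ler_powR; lra.
      by rewrite powRr0 in h.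
    rewrite mul1r lef_pV2 ?posrE ?fpos //; last by lra.
    by apply: fdec => //; exact: pos.
near=> t; have ht : x0 <= t%:R by near: t; exact: nbhs_infty_ger.
have t0 : 0 < t%:R :> R := pos _ ht.
have t0' : t%:R == 0 :> R = false by rewrite gt_eqF.
apply/andP; split.
  have := lo _ ht; rewrite ler_pdivrMr ?fpos // => h.
  have k0 : 0 < K2 by rewrite invr_gt0 fpos //; lra.
  rewrite -(ler_pM2l k0); apply: le_trans h.
  by near: t; apply: near_powR_le; rewrite /e; lra.
have := up _ ht => h.
have p0 : 0 < t%:R `^ (gamma - e) :> R by rewrite powR_gt0.
rewrite -(ler_pM2r p0); apply: le_trans h _.
rewrite -powRD ?t0' ?implybT //.
have : K1 * t%:R `^ 0 <= t%:R `^ (- gamma + eps + (gamma - e)).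
  by near: t; apply: near_powR_le; rewrite /e; lra.
by rewrite powRr0 mulr1.
Unshelve. all: by end_near. Qed.

Lemma near_f_le (f : R -> R) (eta : R) : 0 < eta -> decreases_to_zero f ->
  \forall t \near \oo, f t%:R <= eta.
Proof.
move=> e0 [_ f0]; have [M [_ hM]] : \forall t \near +oo, f t < eta by exact: cvgr_lt f0 _ e0.
near=> t; apply/ltW/hM; near: t; exact: nbhs_infty_gtr.
Unshelve. all: by end_near. Qed.

Lemma near_markov (X : nat -> R) (K b q : R) : 0 <= b -> b < q -> 0 <= K ->
  (\forall t \near \oo, X t <= K * t.+1%:R `^ b) ->
  \forall t \near \oo, X t / t%:R `^ q <= (8 * ln t%:R)^-1.
Proof.
move=> b0 bq K0 hX.
have qb : 0 < q - b by rewrite subr_gt0.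
near=> t; have t0 : 0 < t%:R :> R by rewrite ltr0n; near: t; exact: nbhs_infty_gt.
have t1 : 1 <= t%:R :> R by rewrite ler1n -(ltr0n R).
have h1 : X t <= K * t.+1%:R `^ b by near: t.
have h2 : t.+1%:R `^ b <= 2 `^ b * t%:R `^ b :> R.
  rewrite -powRM //; apply: ge0_ler_powR; rewrite ?nnegrE ?mulr_ge0 //.
  by rewrite -natr1; lra.
apply: (@le_trans _ _ (K * 2 `^ b * t%:R `^ (- (q - b)))); last first.
  by near: t; exact: near_inv_ln.
have E : t%:R `^ (- (q - b)) * t%:R `^ q = t%:R `^ b :> R.
  rewrite -powRD; last by rewrite (gt_eqF t0) implybT.
  by congr (_ `^ _); ring.
rewrite ler_pdivrMr ?powR_gt0 // -!mulrA E.
by apply: le_trans h1 _; rewrite ler_wpM2l.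
Unshelve. all: by end_near. Qed.

Lemma near_truncn_ge (c : R) (N : nat) : 0 < c ->
  \forall t \near \oo, (N <= Num.truncn (t%:R `^ c : R))%N.
Proof.
move=> c0; near=> t; rewrite truncn_ge_nat ?powR_ge0 //.
have : N%:R * t%:R `^ 0 <= t%:R `^ c :> R by near: t; exact: near_powR_le.
by rewrite powRr0 mulr1.
Unshelve. all: by end_near. Qed.

End Asymptotics.

(** * Bounds with high probability *)

Lemma half_split (t s0 : nat) : (0 < t)%N -> (s0.*2 <= t)%N ->
  exists h k l : nat, [/\ (s0 + k = h)%N, (h + l = t)%N, (0 < l)%N,
    (t <= 2 * l)%N & (t <= 2 * h.+1)%N].
Proof.
move=> t0 hs; exists t./2, (t./2 - s0)%N, (t - t./2)%N.
have : (t = odd t + t./2.*2)%N by rewrite odd_double_half.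
by move: (t./2) (odd t) => h b tE; split; case: b tE => /=; lia.
Qed.

Section WithHighProbability.
Context {R : realType} (f : R -> R) (gamma : R).
Hypothesis gamma01 : 0 <= gamma < 1.
Hypothesis f01 : forall x, 0 < x -> 0 < f x <= 1.
Hypothesis fdec : decreases_to_zero f.
Hypothesis frv : regularly_varying f (- gamma).

Lemma probs_f : probs (on_nat f).
Proof. by move=> s; have /andP[/ltW -> ->] := f01 (ltr0Sn R s). Qed.

Lemma mean_affine k s (phi psi : multigraph -> R) (a b c : R) g : valid s g ->
  mean (on_nat f) k s (fun g => a * phi g + b * psi g + c) g =
  a * mean (on_nat f) k s phi g + b * mean (on_nat f) k s psi g + c.
Proof.
move=> vg; rewrite -[c in RHS](mean_cst (on_nat f) k c vg).
rewrite -[a * _ in RHS]meanZ -[b * _ in RHS]meanZ.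
transitivity (mean (on_nat f) k s (((fun g => a * phi g) \+ (fun g => b * psi g)) \+ (fun=> c)) g).
  by [].
by rewrite !meanD.
Qed.

Lemma upper_whp (q : R) : 1 - gamma < q ->
  (\forall t \near \oo, chance (on_nat f) t 0 (fun g => (t%:R `^ q < (adjpairs g)%:R)%R) one_loop
     <= (8 * ln t%:R)^-1) /\
  (\forall t \near \oo, chance (on_nat f) t 0 (fun g => (t%:R `^ q < (tag g)%:R)%R) one_loop
     <= (8 * ln t%:R)^-1).
Proof.
move=> hq; have /andP[g0 g1] := gamma01.
pose e := (q - (1 - gamma)) / 4; have e0 : 0 < e by rewrite divr_gt0 // subr_gt0.
have qE : q = 1 - gamma + 4 * e by rewrite /e; field.
pose a := Num.min 1 (1 - gamma + e).
have a0 : 0 < a by rewrite lt_min ltr01 /=; lra.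
have a1 : a <= 1 by rewrite ge_min lexx.
have aq : a <= 1 - gamma + e by rewrite ge_min lexx orbT.
have a01 : 0 <= a <= 1 by rewrite ltW.
have hp := probs_f.
have [N [N0 hN]] : exists N : nat, (0 < N)%N /\ forall u, (N <= u)%N ->
    f u%:R <= u%:R `^ (a - 1).
  have [M _ hM] := regvar_bounds g0 e0 f01 fdec frv.
  exists (maxn 1 M); split; first by rewrite leq_max.
  move=> u; rewrite geq_max => /andP[u0 /hM /andP[_ hu]].
  rewrite /a; case: (leP 1 (1 - gamma + e)) => h.
    have uR : 0 < u%:R :> R by rewrite ltr0n.
    by rewrite subrr powRr0; case/andP: (f01 uR).
  by rewrite (_ : 1 - gamma + e - 1 = - gamma + e) //; ring.
pose sg s := mean (on_nat f) s 0 (powsum a) one_loop.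
have sg_ge0 s : 0 <= sg s.
  rewrite -(mean_cst (on_nat f) s 0 (valid0)); apply: (mean_le hp valid_closed) valid0 => g _.
  by apply: sumr_ge0 => i _; exact: degpow_ge0.
have sg_rec s : sg s.+1 <= (1 + a / s.+1%:R) * sg s + f s.+1%:R.
  rewrite /sg mean_recr add0n.
  apply: (@le_trans _ _ (mean (on_nat f) s 0 (fun g => (1 + a / s.+1%:R) * powsum a g +
      0 * powsum a g + f s.+1%:R) one_loop)).
    apply: (mean_le hp valid_closed) valid0 => g; rewrite add0n => vg.
    by rewrite mul0r addr0; exact: step_powsum.
  by rewrite (mean_affine _ _ _ _ _ _ valid0) mul0r addr0.
pose b := a + e; have b0 : 0 < b by rewrite addr_gt0.
pose C := 1 + e^-1; have ie : 0 < e^-1 by rewrite invr_gt0.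
have C1 : 1 <= C by rewrite lerDl ltW.
pose r := a + (2 * C)^-1.
have rb : r < b.
  rewrite ltrD2l -[e]invrK ltf_pV2 ?posrE ?mulr_gt0 //; rewrite /C; lra.
have r0 : 0 < r by rewrite addr_gt0 // invr_gt0 mulr_gt0 //; lra.
have ab : a < b by rewrite ltrDl.
have [U [U0 NU hU1 hU2]] : exists U : nat, [/\ (0 < U)%N, (N <= U)%N,
    a + b <= (b - a) * U%:R & r + b <= (b - r) * U%:R].
  have [M1 _ h1] := @nbhs_infty_ger R ((a + b) / (b - a)).
  have [M2 _ h2] := @nbhs_infty_ger R ((r + b) / (b - r)).
  exists (maxn N (maxn M1 M2)); split.
  - by rewrite leq_max N0.
  - by rewrite leq_maxl.
  - have := h1 (maxn N (maxn M1 M2)); rewrite /= !leq_max leqnn orbT => /(_ isT).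
    by rewrite ler_pdivrMr ?subr_gt0 // mulrC.
  - have := h2 (maxn N (maxn M1 M2)); rewrite /= !leq_max leqnn !orbT => /(_ isT).
    by rewrite ler_pdivrMr ?subr_gt0 // mulrC.
have pw1 (u : nat) (y z : R) : (0 < u)%N -> y <= z -> u%:R `^ y <= u%:R `^ z.
  by move=> u0 yz; apply: ler_powR; rewrite ?ler1n.
pose K1 := `|sg U.-1| + 2 * 1 / (b - a).
have K10 : 0 <= K1 by rewrite addr_ge0 // divr_ge0 // subr_ge0 ltW.
have hK1 s : (U <= s.+1)%N -> sg s <= K1 * s.+1%:R `^ b.
  apply: (@power_growth R (fun u => sg u.-1) a b 1 U _ ab _ U0 hU1 _ s.+1) => //; first exact: ltW.
  case=> [|u] hu; first by move: U0; rewrite ltnNge hu.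
  rewrite mul1r; apply: le_trans (sg_rec u) _; rewrite lerD2l.
  apply: le_trans (hN _ (leq_trans NU hu)) _; apply: pw1 => //; rewrite /b; lra.
pose ps s := mean (on_nat f) s 0 (pot C a s.+1%:R) one_loop.
have ps_rec s : ps s.+1 <= (1 + r / s.+1%:R) * ps s +
    f s.+1%:R * (2 + 2 * C * s.+1%:R `^ (- a) * sg s).
  rewrite /ps /sg mean_recr add0n.
  apply: (@le_trans _ _ (mean (on_nat f) s 0 (fun g => (1 + r / s.+1%:R) * pot C a s.+1%:R g +
      (f s.+1%:R * (2 * C * s.+1%:R `^ (- a))) * powsum a g + f s.+1%:R * 2) one_loop)).
    apply: (mean_le hp valid_closed) valid0 => g; rewrite add0n => vg.
    rewrite -(natr1 s.+1); apply: le_trans (step_pot vg a01 C1 (hp s)) _.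
    by rewrite /r le_eqVlt; apply/orP; left; apply/eqP; ring.
  rewrite (mean_affine _ _ _ _ _ _ valid0).
  by rewrite le_eqVlt; apply/orP; left; apply/eqP; ring.
pose B := 2 + 2 * C * K1.
have C0 : 0 <= C by lra.
have B0 : 0 <= B by rewrite addr_ge0 // !mulr_ge0.
pose K2 := `|ps U.-1| + 2 * B / (b - r).
have K20 : 0 <= K2 by rewrite addr_ge0 // divr_ge0 ?mulr_ge0 // subr_ge0 ltW.
have hK2 s : (U <= s.+1)%N -> ps s <= K2 * s.+1%:R `^ b.
  apply: (@power_growth R (fun u => ps u.-1) r b B U _ rb B0 U0 hU2 _ s.+1); first exact: ltW.
  case=> [|u] hu; first by move: U0; rewrite ltnNge hu.
  apply: le_trans (ps_rec u) _; rewrite lerD2l.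
  have uR : u.+1%:R == 0 :> R = false by rewrite pnatr_eq0.
  apply: (@le_trans _ _ (u.+1%:R `^ (a - 1) * (2 + 2 * C * u.+1%:R `^ (- a) * (K1 * u.+1%:R `^ b)))).
    rewrite ler_pM //.
    - by case/andP: (hp u).
    - by rewrite addr_ge0 // !mulr_ge0 ?powR_ge0.
    - exact: hN _ (leq_trans NU hu).
    - by rewrite lerD2l ler_wpM2l ?hK1 // !mulr_ge0 ?powR_ge0.
  have -> : u.+1%:R `^ (a - 1) * (2 + 2 * C * u.+1%:R `^ (- a) * (K1 * u.+1%:R `^ b)) =
     2 * u.+1%:R `^ (a - 1) + 2 * C * K1 * u.+1%:R `^ (b - 1).
    have -> : u.+1%:R `^ (b - 1) = u.+1%:R `^ (a - 1) * (u.+1%:R `^ (- a) * u.+1%:R `^ b).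
      by rewrite -!powRD ?uR ?implybT //; congr (_ `^ _); ring.
    by ring.
  rewrite /B [leRHS]mulrDl; apply: lerD => //; rewrite ler_wpM2l //.
  by apply: pw1 => //; rewrite /b; lra.
have bq : b < q by rewrite qE /b; lra.
have U1 : \forall t \near \oo, (U <= t.+1)%N.
  by exists U => // t /= h; exact: leqW.
split; near=> t; have t0 : (0 < t)%N by near: t; exact: nbhs_infty_gt.
- have pt0 : 0 < t%:R `^ q by rewrite powR_gt0 // ltr0n.
  apply: (@le_trans _ _ (ps t / t%:R `^ q)).
    apply: (chance_markov hp valid_closed pt0) valid0 => g _.
    + apply: le_trans (ler0n _ _) (adjpairs_le_pot a _ g C0).
    + by move=> /ltW h; apply: le_trans h (adjpairs_le_pot a _ g C0).
  near: t; apply: (near_markov (ltW b0) bq K20).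
  by near=> t; apply: hK2; near: t.
- have pt0 : 0 < t%:R `^ q by rewrite powR_gt0 // ltr0n.
  apply: (@le_trans _ _ (sg t / t%:R `^ q)).
    apply: (chance_markov hp valid_closed pt0) valid0 => g vg.
    + by apply: le_trans (ler0n _ _) (tag_le_powsum vg (ltW a0)).
    + by move=> /ltW h; apply: le_trans h (tag_le_powsum vg (ltW a0)).
  near: t; apply: (near_markov (ltW b0) bq K10).
  by near=> t; apply: hK1; near: t.
Unshelve. all: by end_near. Qed.

Lemma small_f_from (e : R) : 0 < e -> exists s0 : nat,
  (forall u, (s0 <= u)%N -> f u%:R <= e) /\ 1 <= e * s0%:R.
Proof.
move=> e0; have [N _ hN] := near_f_le e0 fdec.
have [M _ hM] := @nbhs_infty_ger R e^-1.
exists (maxn N M); split => [u|].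
  by rewrite geq_max => /andP[/hN].
have := hM (maxn N M) (leq_maxr _ _).
by rewrite /= -[e^-1]mulr1 ler_pdivrMl.
Qed.

Lemma hub_whp (q : R) : 0 <= q -> q < 1 - gamma ->
  \forall t \near \oo, chance (on_nat f) t 0 (fun g => ((nbrs g 0)%:R < t%:R `^ q)%R) one_loop
     <= (8 * ln t%:R)^-1.
Proof.
move=> q0 hq; have /andP[g0 g1] := gamma01; have hp := probs_f.
pose e := (1 - gamma - q) / 8; have e0 : 0 < e by rewrite divr_gt0 // subr_gt0.
have qE : 1 - gamma = q + 8 * e by rewrite /e; field.
have e1 : e <= 8^-1 by rewrite /e; lra.
have [s0 [hs0 hs0e]] := small_f_from e0.
pose c : R := (1 - e) / 2.
pose K : R := 2 * (2 * s0.+1%:R) `^ c.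
have K0 : 0 <= K by rewrite mulr_ge0 ?powR_ge0.
have rv := regvar_bounds g0 e0 f01 fdec frv.
near=> t.
have t0n : (0 < t)%N by near: t; exact: nbhs_infty_gt.
have t0 : 0 < t%:R :> R by rewrite ltr0n.
have tz : t%:R == 0 :> R = false by rewrite gt_eqF.
have tp a : 0 < t%:R `^ a :> R by rewrite powR_gt0.
have tD a b : t%:R `^ a * t%:R `^ b = t%:R `^ (a + b) :> R.
  by rewrite powRD // tz implybT.
have s0t : (s0.*2 <= t)%N by near: t; exact: nbhs_infty_ge.
have [h [k [l [kE tE l0 tl th']]]] := half_split t0n s0t.
have lt2 : t%:R <= 2 * l%:R :> R by rewrite -natrM ler_nat.
have th : t%:R <= 2 * h.+1%:R :> R by rewrite -natrM ler_nat.
pose x : R := t%:R `^ (1 - 3 * e).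
have x0 : 0 < x := tp _.
pose fl := f t%:R.
have fl_lo : t%:R `^ (- gamma - e) <= fl.
  have /andP[] : t%:R `^ (- gamma - e) <= f t%:R <= t%:R `^ (- gamma + e) by near: t.
  by [].
have fl0 : 0 < fl := lt_le_trans (tp _) fl_lo.
pose r2 : R := 16 * t%:R `^ (- e).
have r20 : 0 <= r2 by rewrite mulr_ge0 ?powR_ge0.
pose r1 : R := K * t%:R `^ (- e).
have r10 : 0 <= r1 by rewrite mulr_ge0 ?powR_ge0.
have step2 g : valid h g -> ~~ ((ndeg g 0)%:R < x) ->
    chance (on_nat f) l h (fun g => ((nbrs g 0)%:R < t%:R `^ q)%R) g <= r2.
  move=> vg; rewrite -leNgt => hx.
  apply: le_trans (few_nbrs hp _ vg (valid_tag_gt0 vg) (ltW x0) hx (ltW fl0) _ l0) _.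
    move=> u /andP[hu hu']; apply: (proj1 fdec); first by rewrite ltr0n (leq_ltn_trans _ hu).
    by rewrite ler_nat -tE.
  rewrite tE.
  pose w : R := t%:R `^ (1 - gamma - 4 * e).
  have w0 : 0 < w := tp _.
  have hw : 16 * t%:R `^ q <= w.
    by rewrite /w; near: t; apply: near_powR_le; lra.
  have hm : w <= fl * x.
    rewrite /w (_ : 1 - gamma - 4 * e = (- gamma - e) + (1 - 3 * e)); last by ring.
    by rewrite -tD ler_wpM2r // ltW.
  have hbig : w / 8 <= fl * x * l%:R / (4 * t%:R).
    rewrite ler_pdivlMr ?mulr_gt0 //.
    have h1 : w * t%:R <= fl * x * (2 * l%:R) by rewrite ler_pM // ltW.
    lra.
  apply: (@le_trans _ _ (expR (- (w / 16)))); first by rewrite ler_expR; lra.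
  apply: le_trans (expRN_le_inv _) _; first by rewrite divr_gt0.
  rewrite invf_div /r2 ler_wpM2l // -powRN.
  by apply: ler_powR; rewrite ?ler1n //; lra.
have tE' : t = (s0 + (k + l))%N by rewrite addnA kE tE.
rewrite [in X in chance _ X _ _ _]tE'.
apply: (@le_trans _ _ (r1 + r2)); last first.
  rewrite /r1 /r2 -mulrDl; near: t; exact: near_inv_ln.
apply: (chance_cat_uniform hp valid0); first by rewrite addr_ge0.
move=> g vg; rewrite add0n in vg *.
apply: le_trans (chance_cat (B := fun g => ((ndeg g 0)%:R < x)%R) hp vg r20 _) _.
  by rewrite kE.
rewrite lerD2r.
apply: le_trans (@low_degree _ _ hp s0 k g 0 x e vg (valid_tag_gt0 vg) _ _ _ x0) _.
- by rewrite e0 /=; lra.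
- by apply: (le_trans hs0e); rewrite ler_wpM2l ?(ltW e0) // ler_nat.
- by move=> u hu; apply: hs0; exact: ltnW.
rewrite kE -/c /r1 /K -mulrA -mulrA ler_wpM2l //.
have c0 : 0 < c by rewrite /c; lra.
have -> : Num.sqrt x = t%:R `^ ((1 - 3 * e) / 2) by rewrite -powR12_sqrt ?(ltW x0) // -powRrM.
have hr : (s0.+1%:R / h.+1%:R) `^ c <= (2 * s0.+1%:R) `^ c * t%:R `^ (- c) :> R.
  have -> : t%:R `^ (- c) = t%:R^-1 `^ c :> R by rewrite -powR_inv1 ?(ltW t0) // -powRrM mulN1r.
  rewrite -powRM ?mulr_ge0 ?invr_ge0 ?ler0n //.
  apply: (ge0_ler_powR (ltW c0)); rewrite ?nnegrE ?mulr_ge0 ?invr_ge0 ?ler0n //.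
  rewrite ler_pdivrMr ?ltr0n // mulrAC ler_pdivlMr //.
  have := ler_wpM2l (ler0n R s0.+1) th; lra.
apply: le_trans (ler_wpM2l (ltW (tp _)) hr) _.
rewrite mulrCA tD ler_wpM2l ?powR_ge0 //.
by rewrite (_ : (1 - 3 * e) / 2 - c = - e) // /c; field.
Unshelve. all: by end_near. Qed.

Lemma near_core_size (q e : R) : 0 < e -> 0 <= q -> (1 - gamma) / 2 = q + 8 * e ->
  \forall t \near \oo,
    t%:R `^ (q + 2 * e) <= (Num.truncn (t%:R `^ (2^-1 - 4 * e) : R))%:R *
      f (Num.truncn (t%:R `^ (2^-1 - 4 * e) : R))%:R / 4.
Proof.
move=> e0 q0 qE; have /andP[g0 g1] := gamma01.
pose c : R := 2^-1 - 4 * e; have c0 : 0 < c by rewrite /c; lra.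
have [N _ hN] := regvar_bounds g0 e0 f01 fdec frv.
near=> t; set tau := Num.truncn _.
have t1 : 1 <= t%:R :> R by rewrite ler1n; near: t; exact: nbhs_infty_gt.
have tau1 : (0 < tau)%N by rewrite /tau -/c; near: t; exact: near_truncn_ge.
have tauN : (N <= tau)%N by rewrite /tau -/c; near: t; exact: near_truncn_ge.
have tauR : 0 < tau%:R :> R by rewrite ltr0n.
have tau1R : 1 <= tau%:R :> R by rewrite ler1n.
have /andP[f_lo _] := hN tau tauN.
pose a : R := 1 - gamma - e.
have a0 : 0 < a by rewrite /a; lra.
have tc : t%:R `^ c / 2 <= tau%:R.
  have /andP[_] := @truncn_itv R _ (powR_ge0 t%:R c); rewrite -/tau -natr1 => h.
  by rewrite ler_pdivrMr //; lra.
have h1 : tau%:R `^ a <= tau%:R * f tau%:R.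
  have -> : tau%:R `^ a = tau%:R * tau%:R `^ (- gamma - e).
    rewrite -{2}[tau%:R]powRr1 ?ler0n // -powRD; last by rewrite (gt_eqF tauR) implybT.
    by congr (_ `^ _); rewrite /a; ring.
  by rewrite ler_wpM2l // ltW.
have h2 : t%:R `^ (c * a) / 2 <= tau%:R `^ a.
  apply: (@le_trans _ _ ((t%:R `^ c / 2) `^ a)); last first.
    by apply: (ge0_ler_powR (ltW a0)); rewrite ?nnegrE ?divr_ge0 ?powR_ge0 ?ler0n.
  rewrite powRM ?powR_ge0 ?invr_ge0 // -powRrM ler_wpM2l ?powR_ge0 //.
  by apply: ger1_powR; rewrite ?invr_gt0 ?invf_le1 //=; [lra|rewrite /a; lra].
have h3 : t%:R `^ (q + 3 * e) <= t%:R `^ (c * a).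
  apply: ler_powR => //; rewrite /c /a.
  have -> : 1 - gamma - e = 2 * q + 15 * e by lra.
  have e4 : q + 8 * e <= 2^-1 by lra.
  nra.
have : 8 * t%:R `^ (q + 2 * e) <= t%:R `^ (q + 3 * e).
  by near: t; apply: near_powR_le; lra.
lra.
Unshelve. all: by end_near. Qed.

End WithHighProbability.

Lemma triples_whp (R : realType) (f : R -> R) (gamma q : R) : 0 <= gamma < 1 ->
  (forall x, 0 < x -> 0 < f x <= 1) -> decreases_to_zero f ->
  regularly_varying f (- gamma) -> 0 <= q -> q < (1 - gamma) / 2 ->
  \forall t \near \oo, chance (on_nat f) t 0
    (fun g => ((tritriples g)%:R < t%:R `^ (3 * q))%R) one_loop <= (8 * ln t%:R)^-1.
Proof.
move=> gamma01 f01 fdec frv q0 hq; have /andP[g0 g1] := gamma01; have hp := probs_f f01.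
pose e := ((1 - gamma) / 2 - q) / 8; have e0 : 0 < e by rewrite divr_gt0 // subr_gt0.
have qE : (1 - gamma) / 2 = q + 8 * e by rewrite /e; field.
have e1 : e <= 16^-1 by rewrite /e; lra.
have [s0 [hs0 hs0e]] := small_f_from fdec e0.
pose c : R := 2^-1 - 4 * e; have c0 : 0 < c by rewrite /c; lra.
pose c' : R := (1 - e) / 2; have c'0 : 0 < c' by rewrite /c'; lra.
have core := near_core_size gamma01 f01 fdec frv e0 q0 qE.
near=> t.
have t0n : (0 < t)%N by near: t; exact: nbhs_infty_gt.
have t0 : 0 < t%:R :> R by rewrite ltr0n.
have t1 : 1 <= t%:R :> R by rewrite ler1n.
have tz : t%:R == 0 :> R = false by rewrite gt_eqF.
have tp a : 0 < t%:R `^ a :> R by rewrite powR_gt0.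
have tD a b : t%:R `^ a * t%:R `^ b = t%:R `^ (a + b) :> R.
  by rewrite powRD // tz implybT.
pose tau := Num.truncn (t%:R `^ c : R).
have /andP[tau_le tau_gt] := @truncn_itv R _ (powR_ge0 t%:R c).
rewrite -/tau in tau_le tau_gt.
have tau_s0 : (s0 <= tau)%N by rewrite /tau; near: t; exact: near_truncn_ge.
have tc1 : 1 <= t%:R `^ c :> R by have := ler_powR t1 (ltW c0); rewrite powRr0.
have tau2 : (tau.*2 <= t)%N.
  rewrite -(ler_nat R) -mul2n natrM; apply: (@le_trans _ _ (2 * t%:R `^ c)).
    by rewrite ler_wpM2l.
  rewrite -[leRHS]powRr1 ?ler0n //; near: t; apply: near_powR_le.
  by rewrite /c; lra.
have [h [k [l [kE tE l0 tl th']]]] := half_split t0n tau2.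
have lt2 : t%:R <= 2 * l%:R :> R by rewrite -natrM ler_nat.
have th : t%:R <= 2 * h.+1%:R :> R by rewrite -natrM ler_nat.
pose w : R := tau%:R * f tau%:R / 4.
have wE : t%:R `^ (q + 2 * e) <= w by rewrite /w /tau /c; near: t.
have w0 : 0 < w := lt_le_trans (tp _) wE.
have wV : w^-1 <= t%:R `^ (- e).
  rewrite powRN lef_pV2 ?posrE //; apply: le_trans wE.
  by apply: ler_powR => //; lra.
have w2 : 2 * t%:R `^ q <= w.
  by apply: le_trans wE; near: t; apply: near_powR_le; lra.
pose x : R := t%:R `^ (2^-1 + e); have x0 : 0 < x := tp _.
pose r1 : R := 8 * t%:R `^ (- e); have r10 : 0 <= r1 by rewrite mulr_ge0 ?powR_ge0.
pose r : R := 3 * r1; have r0 : 0 <= r by rewrite mulr_ge0.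
have step_edge g i j : valid h g -> i != j -> (i < tag g)%N -> (j < tag g)%N ->
    x <= (ndeg g i)%:R -> x <= (ndeg g j)%:R ->
    chance (on_nat f) l h (fun g => ~~ adj g i j) g <= r1.
  move=> vg ij hi hj xi xj.
  apply: le_trans (few_edges hp vg ij hi hj (ltW x0) xi xj _ l0) _.
    move=> u hu; apply: (@le_trans _ _ e); last by clear -e1; lra.
    by apply: hs0; apply: leq_trans tau_s0 _; apply: leq_trans (ltnW hu); rewrite -kE leq_addr.
  rewrite tE.
  have hbig : t%:R `^ (2 * e) / 8 <= x ^+ 2 * l%:R / (4 * t%:R ^+ 2).
    have -> : x ^+ 2 = t%:R * t%:R `^ (2 * e).
      rewrite expr2 tD -{2}[t%:R]powRr1 ?(ltW t0) // tD.
      by congr (_ `^ _); field.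
    rewrite ler_pdivlMr ?mulr_gt0 ?exprn_gt0 //.
    have := ler_wpM2l (ltW (mulr_gt0 t0 (tp (2 * e)))) lt2; clear; lra.
  apply: (@le_trans _ _ (expR (- (t%:R `^ (2 * e) / 8)))).
    by rewrite ler_expR lerN2.
  apply: le_trans (expRN_le_inv _) _; first by rewrite divr_gt0.
  rewrite invf_div /r1 ler_wpM2l // -powRN.
  by apply: ler_powR => //; clear -e0; lra.
have step_deg g i : valid tau g -> (i < tag g)%N ->
    chance (on_nat f) k tau (fun g => ((ndeg g i)%:R < x)%R) g <= r1.
  move=> vg hi.
  apply: le_trans (@low_degree _ _ hp tau k g i x e vg hi _ _ _ x0) _.
  - by rewrite e0 /=; clear -e1; lra.
  - apply: (le_trans hs0e); rewrite ler_wpM2l ?(ltW e0) // ler_nat; exact: leqW.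
  - by move=> u hu; apply: hs0; apply: leq_trans tau_s0 (ltnW hu).
  rewrite kE -/c' /r1.
  have -> : Num.sqrt x = t%:R `^ ((2^-1 + e) / 2) by rewrite -powR12_sqrt ?(ltW x0) // -powRrM.
  have hr : (tau.+1%:R / h.+1%:R) `^ c' <= 4 * t%:R `^ ((c - 1) * c') :> R.
    apply: (@le_trans _ _ ((4 * t%:R `^ (c - 1)) `^ c')).
      apply: (ge0_ler_powR (ltW c'0)); rewrite ?nnegrE ?mulr_ge0 ?invr_ge0 ?ler0n ?powR_ge0 //.
      rewrite ler_pdivrMr ?ltr0n //.
      have tc' : t%:R `^ c = t%:R `^ (c - 1) * t%:R.
        by rewrite -{3}[t%:R]powRr1 ?(ltW t0) // tD subrK.
      have := ler_wpM2l (ltW (tp (c - 1))) th.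
      by move: tau_le tc1; rewrite -natr1 tc'; clear; lra.
    rewrite powRM ?powR_ge0 // -powRrM ler_wpM2r ?powR_ge0 //.
    by apply: ler1_powR; [clear; lra|rewrite /c'; clear -e0; lra].
  have hm : 0 <= 2 * t%:R `^ ((2^-1 + e) / 2) :> R by rewrite mulr_ge0 ?powR_ge0.
  apply: le_trans (ler_wpM2l hm hr) _.
  have -> : 2 * t%:R `^ ((2^-1 + e) / 2) * (4 * t%:R `^ ((c - 1) * c')) =
     8 * (t%:R `^ ((2^-1 + e) / 2) * t%:R `^ ((c - 1) * c')) :> R by ring.
  rewrite tD ler_wpM2l //; apply: ler_powR => //; rewrite /c /c'; clear -e0 e1; nra.
have step_pair g i j : valid tau g -> (i < tag g)%N -> (j < tag g)%N -> i != j ->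
    chance (on_nat f) (k + l) tau (fun g => ~~ adj g i j) g <= r.
  move=> vg hi hj ij.
  pose B (g' : multigraph) := ((ndeg g' i)%:R < x)%R || ((ndeg g' j)%:R < x)%R.
  pose Q (s : nat) (g' : multigraph) := (i < tag g')%N /\ (j < tag g')%N.
  have Qc : step_closed Q.
    by move=> s g' [h1 h2]; split => [v|u v]; split => //=; exact: leqW.
  have Qg : Q tau g by [].
  apply: le_trans (@chance_cat_in _ Q _ k l tau _ B r1 g hp Qc vg Qg r10 _) _.
    rewrite kE => g' vg' [hi' hj']; rewrite negb_or -!leNgt => /andP[xi xj].
    exact: step_edge.
  have hB : chance (on_nat f) k tau B g <= r1 + r1.
    apply: le_trans (chanceU _ _ _ hp vg) _.
    by apply: lerD; exact: step_deg.
  by rewrite /r; move: hB; clear; lra.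
have tE' : t = (tau + (k + l))%N by rewrite addnA kE tE.
rewrite [in X in chance _ X _ _ _]tE'.
apply: (@le_trans _ _ (t%:R `^ (- e) + 6 * (t%:R `^ (- e) + r))); last first.
  have -> : t%:R `^ (- e) + 6 * (t%:R `^ (- e) + r) = 151 * t%:R `^ (- e) :> R.
    by rewrite /r /r1; ring.
  by near: t; exact: near_inv_ln.
have rr0 : 0 <= 6 * (t%:R `^ (- e) + r) by rewrite mulr_ge0 // addr_ge0 // ltW.
apply: le_trans (chance_cat (B := fun g => ((tag g)%:R < w)%R) hp valid0 rr0 _) _.
  move=> g; rewrite add0n -leNgt => vg hw.
  apply: le_trans (_ : _ <= chance (on_nat f) (k + l) tau (fun g' => (2 * tritriples g' < tag g ^ 3)%N) g) _.
    apply: chance_sub => // g' hT.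
    rewrite -(ltr_nat R) natrM natrX.
    apply: (@lt_le_trans _ _ (2 * t%:R `^ (3 * q))); first by rewrite ltr_pM2l.
    apply: (@le_trans _ _ (w ^+ 3)); last by rewrite lerXn2r ?nnegrE ?ler0n // ltW.
    apply: (@le_trans _ _ ((2 * t%:R `^ q) ^+ 3)); last first.
      have w0' : w \is Num.nneg by rewrite nnegrE ltW.
      by apply: lerXn2r => //; rewrite nnegrE mulr_ge0 ?powR_ge0.
    rewrite exprMn -[X in _ <= _ * X]powR_mulrn ?powR_ge0 // -powRrM (mulrC q).
    by rewrite ler_wpM2r ?powR_ge0 // !exprS expr0; clear; lra.
  apply: le_trans (few_triples hp vg r0 (fun i j hi hj => step_pair g i j vg hi hj)) _.
  rewrite ler_wpM2l // lerD2r; apply: le_trans wV.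
  by rewrite lef_pV2 ?posrE // (lt_le_trans w0).
rewrite lerD2r.
apply: le_trans (few_vertices hp w (fl := f tau%:R) valid0 _ _) _.
- have /andP[/ltW -> ->] // : 0 < f tau%:R <= 1.
  apply: f01; rewrite lt_neqAle ler0n andbT; apply/eqP => z.
  by move: w0; rewrite /w -z mul0r mul0r ltxx.
- move=> u /andP[hu hu']; apply: (proj1 fdec); first by rewrite ltr0n.
  by rewrite ler_nat.
apply: le_trans wV; have -> : w - f tau%:R * tau%:R / 2 = - w by rewrite /w; field.
exact: expRN_le_inv.
Unshelve. all: by end_near. Qed.

Section Clustering.
Context {R : realType}.

Lemma hub_cherries s (g : multigraph) (x : R) : valid s g -> 2 <= x ->
  x <= (nbrs g 0)%:R -> x ^+ 2 / 4 <= (cherries g)%:R.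
Proof.
move=> vg x2 hX; have tag0 := valid_tag_gt0 vg.
apply: (@le_trans _ _ ('C(nbrs g 0, 2))%:R); last first.
  by rewrite ler_nat; exact: (@cherries_ge g (Ordinal tag0)).
have : ('C(nbrs g 0, 2) * 2 = nbrs g 0 * (nbrs g 0).-1)%N.
  by have := bin_ffact (nbrs g 0) 2; rewrite ffactnS ffactn1.
move: (nbrs g 0) hX => [|n] hX /=; first by exfalso; lra.
move=> /(congr1 (fun k : nat => k%:R : R)); rewrite !natrM => hb.
have n1 : n.+1%:R = n%:R + 1 :> R by rewrite natr1.
rewrite n1 in hX hb; nra.
Qed.

Lemma clustering_le (g : multigraph) (x m : R) : 0 < x -> 0 <= m ->
  x ^+ 2 / 4 <= (cherries g)%:R -> (adjpairs g)%:R <= m ^+ 2 ->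
  global_clustering g <= 12 * m ^+ 3 / x ^+ 2 :> R.
Proof.
move=> x0 m0 hC hM.
have hT : (triangles g)%:R <= m ^+ 3.
  apply: (@le_trans _ _ (tritriples g)%:R); first by rewrite ler_nat triangles_le.
  rewrite -(@ler_pXn2r _ 2) ?nnegrE ?exprn_ge0 ?ler0n //.
  apply: (@le_trans _ _ ((adjpairs g)%:R ^+ 3)).
    by rewrite -!natrX ler_nat tritriples_sqr.
  by rewrite exprAC lerXn2r ?nnegrE ?ler0n ?sqr_ge0.
have xx : 0 < x ^+ 2 by rewrite exprn_gt0.
have c0 : 0 < (cherries g)%:R :> R by apply: lt_le_trans hC; rewrite divr_gt0.
rewrite /global_clustering ler_pdivrMr // mulrAC ler_pdivlMr //.
have m3 : 0 <= m ^+ 3 by rewrite exprn_ge0.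
have := ler_wpM2l m3 hC.
have := ler_wpM2r (ltW xx) hT; lra.
Qed.

Lemma clustering_ge (g : multigraph) (y n m : R) : 0 < n -> 0 < m ->
  (0 < cherries g)%N ->
  y <= (tritriples g)%:R -> (tag g)%:R <= n -> (adjpairs g)%:R <= m ->
  y / (9 * (n * m)) <= global_clustering g.
Proof.
move=> n0 m0 c0 hT hn hm.
have hD : y <= 27 * (triangles g)%:R.
  by apply: le_trans hT _; rewrite -natrM ler_nat tritriples_le.
have hC : (cherries g)%:R <= n * m.
  apply: (@le_trans _ _ (tag g * adjpairs g)%:R); first by rewrite ler_nat cherries_le.
  by rewrite natrM ler_pM // ler0n.
have nm : 0 < n * m by rewrite mulr_gt0.
rewrite /global_clustering ler_pdivrMr ?mulr_gt0 // mulrAC ler_pdivlMr ?ltr0n //.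
apply: (@le_trans _ _ (27 * (triangles g)%:R * (cherries g)%:R)).
  by rewrite ler_wpM2r // ler0n.
have := ler_wpM2l (ler0n R (triangles g)) hC; lra.
Qed.

End Clustering.

Theorem theorem3 (R : realType) (delta : R) (hdelta : 0 < delta < 1) :
  exists c1 c2 : R, [/\ 0 < c1, 0 < c2 &
    forall (gamma : R) (f : R -> R),
      0 <= gamma < 1 ->
      (forall x, 0 < x -> 0 < f x <= 1) ->
      decreases_to_zero f ->
      regularly_varying f (- gamma) ->
      exists t0 : nat,
        forall (d : measure_display) (T : measurableType d)
          (P : probability T R)
          (Z : nat -> T -> bool) (G : nat -> T -> multigraph),
          is_graph_process f P Z G ->
          forall t : nat, (t0 <= t)%N ->
            ((1 - 1 / ln t%:R)%:E <=
             P [set w |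
                 (c1 * t%:R `^ (- ((1 - gamma) * (1 + delta) / 2))
                    <= global_clustering (G t w)
                    <= c2 * t%:R `^ (- ((1 - gamma) * (1 - delta) / 2)))%R])%E].
Proof.
have /andP[d0 d1] := hdelta.
exists 1, 1; split => // gamma f gamma01 f01 fdec frv.
have /andP[g0 g1] := gamma01.
pose sg := 1 - gamma; have sg0 : 0 < sg by rewrite subr_gt0.
pose k := delta / 8; have k0 : 0 < k by rewrite divr_gt0.
have sk0 : 0 < sg * k by rewrite mulr_gt0.
pose pu := sg * (1 + k); pose pl := sg * (1 - k).
have pl0 : 0 < pl by rewrite mulr_gt0 // /k; lra.
have hpu : 1 - gamma < pu by rewrite /pu -/sg; lra.
have hpl : pl < 1 - gamma by rewrite /pl -/sg; lra.
have hpl2 : pl / 2 < (1 - gamma) / 2 by lra.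
have [up1 up2] := upper_whp gamma01 f01 fdec frv hpu.
have hub := hub_whp gamma01 f01 fdec frv (ltW pl0) hpl.
have tri := triples_whp gamma01 f01 fdec frv (divr_ge0 (ltW pl0) (ler0n R 2)) hpl2.
have hp := probs_f f01.
pose A (t : nat) (g : multigraph) : bool :=
  1 * t%:R `^ (- ((1 - gamma) * (1 + delta) / 2)) <= global_clustering g
    <= 1 * t%:R `^ (- ((1 - gamma) * (1 - delta) / 2)).
suff [t0 _ ht0] : \forall t \near \oo,
    1 - 1 / ln t%:R <= chance (on_nat f) t 0 (A t) one_loop.
  exists t0 => d T P Z G HP t ht.
  apply: le_trans (chance_le_process HP (A t) t hp).
  by rewrite lee_fin; exact: ht0.
near=> t.
have t2 : 1 < t%:R :> R by near: t; exact: nbhs_infty_gtr.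
have tR : 0 < t%:R :> R by lra.
have tp a : 0 < t%:R `^ a :> R by rewrite powR_gt0.
have tz : t%:R == 0 :> R = false by rewrite gt_eqF.
have tX a n : (t%:R `^ a) ^+ n = t%:R `^ (a * n%:R) :> R by rewrite -powR_mulrn ?powR_ge0 // -powRrM.
have tD a b : t%:R `^ a * t%:R `^ b = t%:R `^ (a + b) :> R by rewrite powRD // tz implybT.
have l0 : 0 < ln t%:R :> R by rewrite ln_gt0.
have x2 : 2 <= t%:R `^ pl :> R.
  have : 2 * t%:R `^ 0 <= t%:R `^ pl :> R by near: t; exact: near_powR_le.
  by rewrite powRr0 mulr1.
have eu : 12 * t%:R `^ (3 / 2 * pu - 2 * pl) <= t%:R `^ (- ((1 - gamma) * (1 - delta) / 2)) :> R.
  near: t; apply: near_powR_le; rewrite -/sg /pu /pl /k.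
  have := mulr_gt0 sg0 d0; lra.
have el : 9 * t%:R `^ (- ((1 - gamma) * (1 + delta) / 2)) <= t%:R `^ (3 * (pl / 2) - 2 * pu) :> R.
  near: t; apply: near_powR_le; rewrite -/sg /pu /pl /k.
  have := mulr_gt0 sg0 d0; lra.
rewrite (chance_compl _ _ _ valid0).
have b1 : chance (on_nat f) t 0 (fun g => (t%:R `^ pu < (adjpairs g)%:R)%R)
  one_loop <= (8 * ln t%:R)^-1 by near: t.
have b2 : chance (on_nat f) t 0 (fun g => (t%:R `^ pu < (tag g)%:R)%R)
  one_loop <= (8 * ln t%:R)^-1 by near: t.
have b3 : chance (on_nat f) t 0 (fun g => ((nbrs g 0)%:R < t%:R `^ pl)%R)
  one_loop <= (8 * ln t%:R)^-1 by near: t.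
have b4 : chance (on_nat f) t 0
  (fun g => ((tritriples g)%:R < t%:R `^ (3 * (pl / 2)))%R)
  one_loop <= (8 * ln t%:R)^-1 by near: t.
pose B1 (g : multigraph) := t%:R `^ pu < (adjpairs g)%:R.
pose B2 (g : multigraph) := t%:R `^ pu < (tag g)%:R.
pose B3 (g : multigraph) := (nbrs g 0)%:R < t%:R `^ pl.
pose B4 (g : multigraph) := (tritriples g)%:R < t%:R `^ (3 * (pl / 2)).
have le4 : chance (on_nat f) t 0 (fun g => (B1 g || B2 g) || (B3 g || B4 g)) one_loop <= 4 * (8 * ln t%:R)^-1.
  apply: le_trans (chanceU _ _ _ hp valid0) _.
  apply: le_trans (lerD (chanceU _ _ _ hp valid0) (chanceU _ _ _ hp valid0)) _.
  move: b1 b2 b3 b4; rewrite -/B1 -/B2 -/B3 -/B4; clear; lra.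
rewrite lerD2l lerN2.
have i8 : 4 * (8 * ln t%:R)^-1 <= 1 / ln t%:R :> R.
  rewrite invfM mulrA ler_wpM2r ?invr_ge0 ?(ltW l0) //; clear; lra.
apply: le_trans (le_trans _ le4) i8.
apply: (chance_le hp valid_closed) valid0 => g vg; apply: contraR.
rewrite !negb_or -!leNgt => /andP[/andP[h1 h2] /andP[h3 h4]].
have hC := hub_cherries vg x2 h3.
have c0 : (0 < cherries g)%N.
  by rewrite -(ltr0n R); apply: lt_le_trans hC; rewrite divr_gt0 ?exprn_gt0.
rewrite /A !mul1r; apply/andP; split.
  apply: le_trans (clustering_ge (tp _) (tp _) c0 h4 h2 h1).
  rewrite ler_pdivlMr ?mulr_gt0 // tD.
  have := ler_wpM2r (ltW (tp (pu + pu))) el.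
  rewrite tD (_ : 3 * (pl / 2) - 2 * pu + (pu + pu) = 3 * (pl / 2)); last by ring.
  clear; lra.
have h1' : (adjpairs g)%:R <= (t%:R `^ (pu / 2)) ^+ 2 :> R.
  by rewrite tX (_ : pu / 2 * 2%:R = pu) //; field.
apply: le_trans (clustering_le (tp _) (ltW (tp _)) hC h1') _.
rewrite !tX; apply: le_trans eu.
rewrite ler_pdivrMr // -[leRHS]mulrA tD le_eqVlt; apply/orP; left; apply/eqP.
by congr (_ * _ `^ _); field.
Unshelve. all: by end_near. Qed.
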